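(* Assume $\mathbf J$ is positive definite (so that $g$ is convex) and that every global maximum point of $f$ has a homogeneous type. Let $k^*$ be the largest homogeneous type among the global maximum points of $f$, and let $\mu^1,\dots,\mu^P$ be the global maximum points of homogeneous type $k^*$. Then, as $N\to\infty$ (with $\alpha$ fixed), the law under $P_N$ of the random vector $(m_1(\sigma),\dots,m_n(\sigma))$ converges weakly to $$\frac{\sum_{p=1}^P b_p\,\delta_{\mu^p}}{\sum_{p=1}^Pb_p},\qquad b_p=\int_{\mathbb{R}^n}\exp\Big(f^{\mu^p}_{2k^*}\Big(\frac{x}{\alpha^{1/(2k^* )}}\Big)\Big)\,dx,$$ where $\delta_{\mu^p}$ is the unit point mass at $\mu^p$.
   Context: Fix $n\ge1$, weights $\alpha_1,\dots,\alpha_n\in(0,1)$ with $\sum_l\alpha_l=1$, a real symmetric $n\times n$ matrix $\mathbf J=(J_{ls})$ with $J_{ll}>0$ (the reduced interaction matrix), and $\mathbf h\in\mathbb{R}^n$. For each $N$, $\{1,\dots,N\}$ is partitioned into disjoint sets $P_1,\dots,P_n$ with $|P_l|=N_l=\alpha_lN$ (the $\alpha_l$ held fixed as $N\to\infty$). For $\sigma\in\Omega_N=\{-1,1\}^N$ let $S_l(\sigma)=\sum_{i\in P_l}\sigma_i$, $m_l(\sigma)=S_l(\sigma)/N_l$, and $H_N(\sigma)=-Ng(m_1(\sigma),\dots,m_n(\sigma))$ with $g(x)=\frac12\sum_{l,s}\alpha_l\alpha_sJ_{ls}x_lx_s+\sum_l\alpha_lh_lx_l$. The Gibbs measure is $P_N(\sigma)=\exp(-H_N(\sigma))/\sum_{\tau\in\Omega_N}\exp(-H_N(\tau))$.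 Define $f(x)=-\frac12\sum_{l,s=1}^n\alpha_l\alpha_sJ_{ls}x_lx_s+\sum_{l=1}^n\alpha_l\ln\cosh\big(\sum_{s=1}^n\alpha_sJ_{ls}x_s+h_l\big)$ on $\mathbb{R}^n$. Homogeneous type: for a global maximum point $\mu$ of $f$, write the Taylor expansion $f(\mu+y)=f(\mu)+\sum_{j\ge1}T_j(y)$ with $T_j$ homogeneous polynomials of degree $j$; $\mu$ has homogeneous type $k$ (a positive integer) if $T_j\equiv0$ for $1\le j\le 2k-1$ and $T_{2k}(y)<0$ for all $y\neq0$; then set $f^{\mu}_{2k}=T_{2k}$. Vector notation: for $x\in\mathbb{R}^n$ and $\gamma\in\mathbb{R}$, $x/\alpha^{\gamma}=(x_1/\alpha_1^{\gamma},\dots,x_n/\alpha_n^{\gamma})$. *)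

(* Defs.v *)
(* classical reals. Vectors of R^n are represented as
   functions nat -> R, of which only the coordinates 0..n-1 matter
   (index l of the paper corresponds to l-1 here). *)
From Stdlib Require Import Reals Lra List ZArith.
Open Scope R_scope.

Definition vec := nat -> R.

Fixpoint sumR (n : nat) (F : nat -> R) : R :=
  match n with O => 0 | S m => sumR m F + F m end.

Fixpoint prodR (n : nat) (F : nat -> R) : R :=
  match n with O => 1 | S m => prodR m F * F m end.

Fixpoint sumN (n : nat) (F : nat -> nat) : nat :=
  match n with O => O | S m => (sumN m F + F m)%nat end.

Definition eqv (n : nat) (x y : vec) : Prop := forall i, (i < n)%nat -> x i = y i.
Definition is_zero_vec (n : nat) (x : vec) : Prop := forall i, (i < n)%nat -> x i = 0.

Definition vadd (x y : vec) : vec := fun i => x i + y i.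
Definition vsub (x y : vec) : vec := fun i => x i - y i.

Definition normv (n : nat) (x : vec) : R := sqrt (sumR n (fun i => x i ^ 2)).

Definition quadJ (n : nat) (alpha : nat -> R) (J : nat -> nat -> R) (x : vec) : R :=
  sumR n (fun l => sumR n (fun s => alpha l * alpha s * J l s * x l * x s)).

Definition g_fun (n : nat) (alpha : nat -> R) (J : nat -> nat -> R) (h : nat -> R)
  (x : vec) : R :=
  / 2 * quadJ n alpha J x + sumR n (fun l => alpha l * h l * x l).

Definition f_fun (n : nat) (alpha : nat -> R) (J : nat -> nat -> R) (h : nat -> R)
  (x : vec) : R :=
  - / 2 * quadJ n alpha J x
  + sumR n (fun l => alpha l *
       ln (cosh (sumR n (fun s => alpha s * J l s * x s) + h l))).

Definition symmetric_mat (n : nat) (J : nat -> nat -> R) : Prop :=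
  forall l s, (l < n)%nat -> (s < n)%nat -> J l s = J s l.

Definition pos_def (n : nat) (J : nat -> nat -> R) : Prop :=
  symmetric_mat n J /\
  forall x : vec, ~ is_zero_vec n x ->
    0 < sumR n (fun l => sumR n (fun s => J l s * x l * x s)).

(* all configurations sigma in {-1,1}^N, encoded as bool lists (true = +1) *)
Fixpoint configs (N : nat) : list (list bool) :=
  match N with
  | O => nil :: nil
  | S m => flat_map (fun s => (true :: s) :: (false :: s) :: nil) (configs m)
  end.

Definition spin (sigma : list bool) (i : nat) : R :=
  if nth i sigma false then 1 else -1.

(* part i = the block (in 0..n-1) containing site i (sites are 0..N-1) *)
Definition block_size (N : nat) (part : nat -> nat) (l : nat) : nat :=
  length (filter (fun i => Nat.eqb (part i) l) (seq 0 N)).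

Definition block_sum (N : nat) (part : nat -> nat) (sigma : list bool) (l : nat) : R :=
  sumR N (fun i => if Nat.eqb (part i) l then spin sigma i else 0).

Definition magn (N : nat) (part : nat -> nat) (sigma : list bool) : vec :=
  fun l => block_sum N part sigma l / INR (block_size N part l).

Definition valid_partition (n : nat) (alpha : nat -> R) (N : nat) (part : nat -> nat)
  : Prop :=
  (forall i, (i < N)%nat -> (part i < n)%nat) /\
  (forall l, (l < n)%nat -> INR (block_size N part l) = alpha l * INR N).

(* Gibbs weight exp(-H_N(sigma)) = exp(N g(m(sigma))) *)
Definition gibbs_weight (n : nat) (alpha : nat -> R) (J : nat -> nat -> R)
  (h : nat -> R) (N : nat) (part : nat -> nat) (sigma : list bool) : R :=
  exp (INR N * g_fun n alpha J h (magn N part sigma)).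

Definition gibbs_expect (n : nat) (alpha : nat -> R) (J : nat -> nat -> R)
  (h : nat -> R) (N : nat) (part : nat -> nat) (phi : vec -> R) : R :=
  fold_right (fun sigma acc =>
      gibbs_weight n alpha J h N part sigma * phi (magn N part sigma) + acc) 0 (configs N)
  / fold_right (fun sigma acc => gibbs_weight n alpha J h N part sigma + acc) 0 (configs N).

Definition depends_on_first (n : nat) (phi : vec -> R) : Prop :=
  forall x y, eqv n x y -> phi x = phi y.

Definition continuous_Rn (n : nat) (phi : vec -> R) : Prop :=
  forall x eps, 0 < eps -> exists delta, 0 < delta /\
    forall y, normv n (vsub x y) < delta -> Rabs (phi x - phi y) < eps.

Definition bounded_fun (phi : vec -> R) : Prop :=
  exists M, forall x, Rabs (phi x) <= M.

Definition monomial (n : nat) (e : nat -> nat) (y : vec) : R :=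
  prodR n (fun i => y i ^ e i).

Definition hom_poly (n d : nat) (T : vec -> R) : Prop :=
  exists terms : list (R * (nat -> nat)),
    (forall t, In t terms -> sumN n (snd t) = d) /\
    forall y, T y = fold_right (fun t acc => fst t * monomial n (snd t) y + acc) 0 terms.

(* mu has homogeneous type k for F, with f^mu_{2k} = T: the Taylor expansion of
   F at mu has T_1 = ... = T_{2k-1} = 0 and T_{2k} = T negative definite, i.e.
   F(mu+y) = F(mu) + T(y) + o(|y|^{2k}) with T homogeneous of degree 2k. *)
Definition hom_type (n : nat) (F : vec -> R) (mu : vec) (k : nat) (T : vec -> R)
  : Prop :=
  (1 <= k)%nat /\
  hom_poly n (2 * k) T /\
  (forall y, ~ is_zero_vec n y -> T y < 0) /\
  (forall eps, 0 < eps -> exists delta, 0 < delta /\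
     forall y, 0 < normv n y < delta ->
       Rabs (F (vadd mu y) - F mu - T y) <= eps * normv n y ^ (2 * k)).

Definition global_max (n : nat) (F : vec -> R) (mu : vec) : Prop :=
  forall y, F y <= F mu.

Definition zrange (K : nat) : list Z :=
  map (fun j => (Z.of_nat j - Z.of_nat K)%Z) (seq 0 (2 * K + 1)).

Fixpoint ivecs (d K : nat) : list (list Z) :=
  match d with
  | O => nil :: nil
  | S d' => flat_map (fun z => map (cons z) (ivecs d' K)) (zrange K)
  end.

Definition grid_point (z : list Z) (hh : R) : vec :=
  fun i => IZR (nth i z 0%Z) * hh.

Definition riemann_sum (n : nat) (F : vec -> R) (R0 hh : R) : R :=
  hh ^ n * fold_right (fun z acc => F (grid_point z hh) + acc) 0
                      (ivecs n (Z.to_nat (up (R0 / hh)))).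

(* int_{R^n} F(x) dx = I, as the limit R -> oo of the Riemann integrals over
   the boxes [-R,R]^n (suitable for continuous nonnegative F). *)
Definition integral_Rn (n : nat) (F : vec -> R) (I : R) : Prop :=
  forall eps, 0 < eps -> exists Rmin, 0 < Rmin /\
    forall Rb, Rmin <= Rb -> exists hmax, 0 < hmax /\
      forall hh, 0 < hh < hmax -> Rabs (riemann_sum n F Rb hh - I) < eps.

Definition vdiv_pow (alpha : nat -> R) (gamma : R) (x : vec) : vec :=
  fun l => x l / Rpower (alpha l) gamma.

(* Main.v *)
Require Import Defs.
From Stdlib Require Import Reals Lra Lia List ZArith Classical FunctionalExtensionality.
From Coquelicot Require Import Coquelicot.
Open Scope R_scope.

(* The density exp (N g) is linearized by a Gaussian: summed over configurations,
   exp (N g(m)) exp (- N/2 Q(x - m)) equals 2^N exp (N f(x)) for every x, where Q is the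
   quadratic form of f. Integrating in x, and using that the Gaussian concentrates at m
   uniformly in the configuration, the Gibbs average of phi is asymptotically the ratio of
   the integrals of phi exp (N f) and exp (N f). Near a maximum mu of type k, exp (N (f - f(mu)))
   is exp (N T_2k(x - mu)) up to an error that is a small multiple of exp (N T_2k(x - mu) / 2);
   by homogeneity these have integrals proportional to N^(- n/2k), so only the maxima of the
   largest type survive. Replacing T_2k(x) by T_2k(x / alpha^(1/2k)) multiplies all the
   integrals by one and the same constant. *)

(** * Finite sums and products *)

(** Integrals over R^n are limits of lattice sums, as in the statement; what is used of them is
    linearity, monotonicity, positivity, scaling, translation, and existence under Gaussian
    domination. Dominated convergence is replaced by pointwise bounds: an error is at most a small
    multiple of the leading term plus an everywhere defined majorant whose integral is of lower
    order, and only then is anything integrated. The threshold [N0] has to be found before the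
    partition. This is possible because the kernel exp(- N/2 Q(x - m)) has the same integral for
    every centre [m], so that it cancels in the Gibbs ratio, and because the linearized density
    depends on the partition only through alpha. Positive definiteness makes the kernel integrable;
    it also makes [f] decrease quadratically, which disposes of the neighbourhood of infinity. *)

Lemma sumR_ext n F G : (forall i, (i < n)%nat -> F i = G i) -> sumR n F = sumR n G.
Proof.
  induction n as [|n IH]; intros H; simpl; [reflexivity|].
  rewrite IH by (intros; apply H; lia). now rewrite H by lia.
Qed.

Lemma sumR_plus n F G : sumR n (fun i => F i + G i) = sumR n F + sumR n G.
Proof. induction n as [|n IH]; simpl; [lra | rewrite IH; lra]. Qed.

Lemma sumR_minus n F G : sumR n (fun i => F i - G i) = sumR n F - sumR n G.
Proof. induction n as [|n IH]; simpl; [lra | rewrite IH; lra]. Qed.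

Lemma sumR_scal n c F : sumR n (fun i => c * F i) = c * sumR n F.
Proof. induction n as [|n IH]; simpl; [lra | rewrite IH; lra]. Qed.

Lemma sumR_const n c : sumR n (fun _ => c) = INR n * c.
Proof.
  induction n as [|n IH]; [simpl; lra|].
  rewrite S_INR; simpl sumR; rewrite IH; lra.
Qed.

Lemma sumR_le n F G : (forall i, (i < n)%nat -> F i <= G i) -> sumR n F <= sumR n G.
Proof.
  induction n as [|n IH]; intros H; simpl; [lra|].
  specialize (IH (fun i Hi => H i (Nat.lt_lt_succ_r _ _ Hi))).
  specialize (H n (Nat.lt_succ_diag_r n)). lra.
Qed.

Lemma sumR_nonneg n F : (forall i, (i < n)%nat -> 0 <= F i) -> 0 <= sumR n F.
Proof.
  intros H. rewrite <- (Rmult_0_r (INR n)), <- sumR_const. now apply sumR_le.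
Qed.

Lemma sumR_Rabs n F : Rabs (sumR n F) <= sumR n (fun i => Rabs (F i)).
Proof.
  induction n as [|n IH]; simpl; [rewrite Rabs_R0; lra|].
  eapply Rle_trans; [apply Rabs_triang | lra].
Qed.

Lemma sumR_term_le n F i :
  (forall j, (j < n)%nat -> 0 <= F j) -> (i < n)%nat -> F i <= sumR n F.
Proof.
  induction n as [|n IH]; intros H Hi; [lia|]; simpl.
  assert (0 <= F n) by (apply H; lia).
  destruct (Nat.eq_dec i n) as [->|Hne].
  - assert (0 <= sumR n F) by (apply sumR_nonneg; intros; apply H; lia). lra.
  - assert (F i <= sumR n F) by (apply IH; [intros; apply H|]; lia). lra.
Qed.

Lemma sumR_pos n F i : (forall j, (j < n)%nat -> 0 <= F j) -> (i < n)%nat -> 0 < F i ->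
  0 < sumR n F.
Proof. intros H Hi Hp. eapply Rlt_le_trans; [exact Hp | now apply sumR_term_le]. Qed.

Lemma sumR_swap n m F :
  sumR n (fun i => sumR m (fun j => F i j)) = sumR m (fun j => sumR n (fun i => F i j)).
Proof.
  induction n as [|n IH]; simpl.
  - rewrite sumR_const; lra.
  - now rewrite IH, sumR_plus.
Qed.

Lemma sumR_first n F : sumR (S n) F = F O + sumR n (fun i => F (S i)).
Proof.
  induction n as [|n IH]; [simpl; lra|].
  change (sumR (S (S n)) F) with (sumR (S n) F + F (S n)).
  rewrite IH. simpl. lra.
Qed.

Lemma sumR_add n m F : sumR (n + m) F = sumR n F + sumR m (fun i => F (n + i)%nat).
Proof.
  induction m as [|m IH]; [rewrite Nat.add_0_r; simpl; lra|].
  rewrite Nat.add_succ_r; simpl. rewrite IH; lra.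
Qed.

Lemma prodR_first n F : prodR (S n) F = F O * prodR n (fun i => F (S i)).
Proof.
  induction n as [|n IH]; [simpl; lra|].
  change (prodR (S (S n)) F) with (prodR (S n) F * F (S n)).
  rewrite IH. simpl. lra.
Qed.

Lemma prodR_pos n F : (forall i, (i < n)%nat -> 0 < F i) -> 0 < prodR n F.
Proof.
  induction n as [|n IH]; intros H; simpl; [lra|].
  apply Rmult_lt_0_compat; [apply IH; intros; apply H | apply H]; lia.
Qed.

Lemma prodR_const n c : prodR n (fun _ => c) = c ^ n.
Proof. induction n as [|n IH]; simpl; [reflexivity | rewrite IH; ring]. Qed.

Lemma finite_upper_bound n (F : nat -> R) : exists M, 0 < M /\ forall i, (i < n)%nat -> F i <= M.
Proof.
  induction n as [|n (M & HM & H)]; [exists 1; split; [lra | intros; lia]|].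
  exists (Rmax M (F n)). split; [eapply Rlt_le_trans; [exact HM | apply Rmax_l]|].
  intros i Hi. destruct (Nat.eq_dec i n) as [->|]; [apply Rmax_r|].
  eapply Rle_trans; [apply H; lia | apply Rmax_l].
Qed.

Lemma finite_lower_bound n (F : nat -> R) : (forall i, (i < n)%nat -> 0 < F i) ->
  exists m, 0 < m /\ forall i, (i < n)%nat -> m <= F i.
Proof.
  intros H. destruct (finite_upper_bound n (fun i => / F i)) as (M & HM & HF).
  exists (/ M). split; [now apply Rinv_0_lt_compat|].
  intros i Hi. rewrite <- (Rinv_inv (F i)).
  apply Rinv_le_contravar; [apply Rinv_0_lt_compat|]; auto.
Qed.

Lemma sumR_delta n p c (v : nat -> R) : (p < n)%nat ->
  sumR n (fun l => (if Nat.eqb p l then c else 0) * v l) = c * v p.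
Proof.
  induction n as [|n IH]; intros Hp; [lia|]. simpl.
  destruct (Nat.eqb_spec p n) as [->|Hne].
  - rewrite (sumR_ext n _ (fun _ => 0)), sumR_const; [ring|].
    intros i Hi. destruct (Nat.eqb_spec n i); [lia | ring].
  - rewrite IH by lia. ring.
Qed.

(** Only finitely many choices are made, so induction on [P] replaces a choice axiom. *)
Lemma finite_choice (P : nat) (Rel : nat -> R -> Prop) :
  (forall p, (p < P)%nat -> exists y, Rel p y) ->
  exists f, forall p, (p < P)%nat -> Rel p (f p).
Proof.
  induction P as [|P IH]; intros H; [exists (fun _ => 0); intros; lia|].
  destruct IH as (f & Hf); [intros; apply H; lia|].
  destruct (H P) as (y & Hy); [lia|].
  exists (fun p => if Nat.eqb p P then y else f p). intros p Hp.
  destruct (Nat.eqb_spec p P) as [->|]; [exact Hy | apply Hf; lia].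
Qed.

(** * Lattice sums in one variable *)

(** The derivative of [atan]: an integrable weight whose lattice sums can be bounded by the mean
    value theorem and a telescoping sum. All decay is measured against it. *)
Definition w1 (t : R) : R := / (1 + t ^ 2).

Lemma w1_pos t : 0 < w1 t.
Proof. unfold w1. apply Rinv_0_lt_compat. nra. Qed.

Lemma w1_le_1 t : w1 t <= 1.
Proof. unfold w1. rewrite <- Rinv_1 at 2. apply Rinv_le_contravar; nra. Qed.

(** From t^2 <= 2 s^2 + 2 one gets 1 + t^2 <= 3 (1 + s^2); this is the source of the factors 3
    below. *)
Lemma w1_shift s t : Rabs (s - t) <= 1 -> w1 s <= 3 * w1 t.
Proof.
  intros H. apply Rabs_le_between in H. unfold w1.
  replace (3 * / (1 + t ^ 2)) with (/ ((1 + t ^ 2) / 3)) by (field; nra).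
  apply Rinv_le_contravar; [|assert ((s - t) ^ 2 <= 1)]; nra.
Qed.

Lemma w1_far t r : 0 <= r -> r <= Rabs t -> w1 t <= / (1 + r ^ 2).
Proof.
  intros Hr H. unfold w1. apply Rinv_le_contravar; [nra|].
  rewrite <- (pow2_abs t). nra.
Qed.

Definition lsum (h a : R) (K : nat) (G : R -> R) : R :=
  h * sumR (2 * K + 1) (fun j => G (a + (INR j - INR K) * h)).

Lemma lsum_le h a K G G' : 0 <= h -> (forall t, G t <= G' t) -> lsum h a K G <= lsum h a K G'.
Proof. intros Hh H. apply Rmult_le_compat_l; [exact Hh | now apply sumR_le]. Qed.

Lemma lsum_ext h a K G G' : (forall t, G t = G' t) -> lsum h a K G = lsum h a K G'.
Proof. intros H. unfold lsum. f_equal. now apply sumR_ext. Qed.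

Lemma lsum_plus h a K G G' : lsum h a K (fun t => G t + G' t) = lsum h a K G + lsum h a K G'.
Proof. unfold lsum. rewrite sumR_plus. ring. Qed.

Lemma lsum_scal h a K c G : lsum h a K (fun t => c * G t) = c * lsum h a K G.
Proof. unfold lsum. rewrite sumR_scal. ring. Qed.

(** On each cell the increment of [atan] is h * w1 c for some c of the cell, and [w1] at the left
    end is at most 3 * w1 c because h <= 1. *)
Lemma cell_sum_w1 h a m : 0 < h <= 1 ->
  h * sumR m (fun j => w1 (a + INR j * h)) <= 3 * (atan (a + INR m * h) - atan a).
Proof.
  intros Hh. induction m as [|m IH].
  - simpl. rewrite Rmult_0_l, Rplus_0_r. lra.
  - rewrite S_INR. simpl sumR.
    destruct (MVT_cor2 atan (fun x => / (1 + x ^ 2)) (a + INR m * h) (a + (INR m + 1) * h))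
      as (c & Hc & Hb); [nra | intros; apply derivable_pt_lim_atan |].
    assert (w1 (a + INR m * h) <= 3 * w1 c)
      by (apply w1_shift, Rabs_le; nra).
    unfold w1 in H at 2. 
    replace (a + (INR m + 1) * h - (a + INR m * h)) with h in Hc by ring.
    nra.
Qed.

Lemma lsum_shape h a K G :
  lsum h a K G = h * sumR (2 * K + 1) (fun j => G (a - INR K * h + INR j * h)).
Proof. unfold lsum. f_equal. apply sumR_ext. intros; f_equal; ring. Qed.

Lemma lsum_w1 h a K : 0 < h <= 1 -> lsum h a K w1 <= 3 * PI.
Proof.
  intros Hh. rewrite lsum_shape.
  eapply Rle_trans; [apply cell_sum_w1; exact Hh|].
  pose proof (atan_bound (a - INR K * h + INR (2 * K + 1) * h)).
  pose proof (atan_bound (a - INR K * h)). lra.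
Qed.

Lemma lsum_Rabs_w1 h a K B G : 0 < h <= 1 -> (forall t, Rabs (G t) <= B * w1 t) ->
  Rabs (lsum h a K G) <= 3 * PI * B.
Proof.
  intros Hh HG.
  assert (0 <= B).
  { pose proof (w1_pos 0). pose proof (Rabs_pos (G 0)). specialize (HG 0). nra. }
  assert (H1 : lsum h a K G <= lsum h a K (fun t => B * w1 t)).
  { apply lsum_le; [lra|]. intros t. eapply Rle_trans; [apply Rle_abs | apply HG]. }
  assert (H2 : lsum h a K (fun t => (- B) * w1 t) <= lsum h a K G).
  { apply lsum_le; [lra|]. intros t. specialize (HG t). apply Rabs_le_between in HG. lra. }
  rewrite lsum_scal in H1, H2. pose proof (lsum_w1 h a K Hh).
  apply Rabs_le. nra.
Qed.

(** The only appeal to a library integral; afterwards one works with the primitive alone. *)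
Lemma antiderivative_exists G : (forall t, continuity_pt G t) ->
  exists Phi, forall t, derivable_pt_lim Phi t (G t).
Proof.
  intros HG. exists (RInt G 0). intros t. apply is_derive_Reals.
  apply (is_derive_RInt G (RInt G 0) 0 t).
  - apply filter_forall. intros x. apply (RInt_correct (V := R_CompleteNormedModule)).
    apply (ex_RInt_continuous (V := R_CompleteNormedModule)).
    intros z _. apply continuity_pt_filterlim, HG.
  - apply continuity_pt_filterlim, HG.
Qed.

(** The nodes are the left ends of cells tiling [[a - K h, a + (K + 1) h]], whence the asymmetric
    bounds. Since the modulus of continuity carries the weight [w1], the cell errors sum to at most
    3 * PI * eta whatever the number of cells. *)
Lemma lsum_primitive h a K G Phi eta delta :
  0 < h <= 1 -> h <= delta ->
  (forall t, derivable_pt_lim Phi t (G t)) ->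
  (forall s t, Rabs (s - t) <= delta -> Rabs (G s - G t) <= eta * w1 t) ->
  Rabs (lsum h a K G - (Phi (a + (INR K + 1) * h) - Phi (a - INR K * h))) <= 3 * PI * eta.
Proof.
  intros Hh Hd HPhi HG.
  assert (Heta : 0 <= eta).
  { specialize (HG 0 0). rewrite !Rminus_diag, Rabs_R0 in HG. pose proof (w1_pos 0). nra. }
  rewrite lsum_shape. set (b := a - INR K * h).
  assert (cells : forall m, Rabs (h * sumR m (fun j => G (b + INR j * h))
      - (Phi (b + INR m * h) - Phi b)) <= eta * (h * sumR m (fun j => w1 (b + INR j * h)))).
  { induction m as [|m IH].
    - simpl. rewrite Rmult_0_l, Rplus_0_r, Rminus_diag, Rmult_0_r, Rminus_diag, Rabs_R0. lra.
    - rewrite S_INR. simpl sumR.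
      destruct (MVT_cor2 Phi G (b + INR m * h) (b + (INR m + 1) * h))
        as (c & Hc & Hb); [nra | intros; apply HPhi |].
      assert (Rabs (G c - G (b + INR m * h)) <= eta * w1 (b + INR m * h))
        by (apply HG, Rabs_le; nra).
      replace (b + (INR m + 1) * h - (b + INR m * h)) with h in Hc by ring.
      apply Rabs_le_between in IH. apply Rabs_le_between in H.
      apply Rabs_le. nra. }
  specialize (cells (2 * K + 1)%nat).
  pose proof (cell_sum_w1 h b (2 * K + 1) Hh) as Hw.
  pose proof (atan_bound (b + INR (2 * K + 1) * h)).
  pose proof (atan_bound b).
  replace (b + INR (2 * K + 1) * h) with (a + (INR K + 1) * h) in *
    by (unfold b; rewrite plus_INR, mult_INR; simpl; ring).
  eapply Rle_trans; [exact cells|].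
  rewrite (Rmult_comm _ eta). apply Rmult_le_compat_l; lra.
Qed.

(** Phi + c atan does not decrease and Phi - c atan does not increase on [s, t], while [atan] varies
    by less than PI. A plain mean value bound would grow with t - s. *)
Lemma primitive_increment_bound G Phi c s t :
  (forall x, derivable_pt_lim Phi x (G x)) -> s <= t ->
  (forall x, s <= x <= t -> Rabs (G x) <= c * w1 x) ->
  Rabs (Phi t - Phi s) <= PI * c.
Proof.
  intros HPhi Hst HG.
  pose proof (atan_bound s). pose proof (atan_bound t). pose proof PI_RGT_0.
  assert (0 <= c).
  { pose proof (w1_pos s). pose proof (Rabs_pos (G s)).
    assert (Rabs (G s) <= c * w1 s) by (apply HG; lra). nra. }
  destruct (Req_dec s t) as [->|Hne]; [rewrite Rminus_diag, Rabs_R0; nra|].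
  assert (D : forall e x, derivable_pt_lim (fun y => Phi y + e * atan y) x (G x + e * w1 x)).
  { intros e x. apply derivable_pt_lim_plus; [apply HPhi|].
    apply (derivable_pt_lim_scal atan e). apply derivable_pt_lim_atan. }
  destruct (MVT_cor2 _ _ s t (ltac:(lra)) (fun x _ => D c x)) as (x & Hx & Hxb).
  destruct (MVT_cor2 _ _ s t (ltac:(lra)) (fun x _ => D (- c) x)) as (y & Hy & Hyb).
  assert (Gx : Rabs (G x) <= c * w1 x) by (apply HG; lra).
  assert (Gy : Rabs (G y) <= c * w1 y) by (apply HG; lra).
  apply Rabs_le_between in Gx. apply Rabs_le_between in Gy.
  assert (0 <= (G x + c * w1 x) * (t - s)) by (apply Rmult_le_pos; lra).
  assert (0 <= - (G y + - c * w1 y) * (t - s)) by (apply Rmult_le_pos; lra).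
  apply Rabs_le. nra.
Qed.

(** Both sums are compared with Phi r - Phi (- r), which does not depend on the lattice. Of the two
    factors [w1] in the decay of G, one is small beyond r and the other pays for the integration of
    the tail. *)
Lemma lsum_cauchy G A eta delta r h a K h' a' K' :
  (forall t, continuity_pt G t) ->
  (forall t, Rabs (G t) <= A * w1 t ^ 2) ->
  (forall s t, Rabs (s - t) <= delta -> Rabs (G s - G t) <= eta * w1 t) ->
  0 <= r ->
  0 < h <= 1 -> h <= delta -> Rabs a + r <= INR K * h ->
  0 < h' <= 1 -> h' <= delta -> Rabs a' + r <= INR K' * h' ->
  Rabs (lsum h a K G - lsum h' a' K' G) <= 6 * PI * eta + 4 * PI * (A / (1 + r ^ 2)).
Proof.
  intros Hc HA HG Hr Hh Hd Hk Hh' Hd' Hk'.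
  destruct (antiderivative_exists G Hc) as (Phi & HPhi).
  assert (HA0 : 0 <= A).
  { specialize (HA 0). pose proof (Rabs_pos (G 0)). pose proof (pow_lt _ 2 (w1_pos 0)). nra. }
  assert (far : forall x, r <= Rabs x -> Rabs (G x) <= A / (1 + r ^ 2) * w1 x).
  { intros x Hx. eapply Rle_trans; [apply HA|].
    pose proof (w1_far x r Hr Hx). pose proof (w1_pos x).
    unfold Rdiv. replace (w1 x ^ 2) with (w1 x * w1 x) by ring.
    rewrite Rmult_assoc. apply Rmult_le_compat_l; [exact HA0|].
    apply Rmult_le_compat_r; lra. }
  assert (tails : forall h a K, 0 < h -> Rabs a + r <= INR K * h ->
     Rabs ((Phi (a + (INR K + 1) * h) - Phi (a - INR K * h)) - (Phi r - Phi (- r)))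
       <= 2 * PI * (A / (1 + r ^ 2))).
  { intros u b k Hu Hb. pose proof (Rle_abs b). pose proof (Rle_abs (- b)) as Hb'.
    rewrite Rabs_Ropp in Hb'.
    assert (T1 : Rabs (Phi (b + (INR k + 1) * u) - Phi r) <= PI * (A / (1 + r ^ 2))).
    { apply primitive_increment_bound with G; [exact HPhi | nra |].
      intros x Hx. apply far. pose proof (Rle_abs x). lra. }
    assert (T2 : Rabs (Phi (- r) - Phi (b - INR k * u)) <= PI * (A / (1 + r ^ 2))).
    { apply primitive_increment_bound with G; [exact HPhi | nra |].
      intros x Hx. apply far. pose proof (Rle_abs (- x)) as X. rewrite Rabs_Ropp in X. lra. }
    apply Rabs_le_between in T1. apply Rabs_le_between in T2. apply Rabs_le. lra. }
  pose proof (lsum_primitive h a K G Phi eta delta Hh Hd HPhi HG) as L.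
  pose proof (lsum_primitive h' a' K' G Phi eta delta Hh' Hd' HPhi HG) as L'.
  pose proof (tails h a K (proj1 Hh) Hk) as U.
  pose proof (tails h' a' K' (proj1 Hh') Hk') as U'.
  apply Rabs_le_between in L, L', U, U'. apply Rabs_le. lra.
Qed.
(** * Compactness of boxes *)

Definition near (n : nat) (d : R) (x y : vec) : Prop :=
  forall i, (i < n)%nat -> Rabs (x i - y i) < d.

Definition inbox (n : nat) (r : R) (x : vec) : Prop :=
  forall i, (i < n)%nat -> Rabs (x i) <= r.

Definition set_coord (x : vec) (k : nat) (t : R) : vec :=
  fun i => if Nat.eqb i k then t else x i.

Lemma near_sym n d x y : near n d x y -> near n d y x.
Proof. intros H i Hi. rewrite Rabs_minus_sym. now apply H. Qed.

Lemma near_mono n d d' x y : d <= d' -> near n d x y -> near n d' x y.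
Proof. intros Hd H i Hi. specialize (H i Hi). lra. Qed.

(* Induction on the dimension: by the tube argument every slab around a value of
   the last coordinate is good, and a supremum argument covers that coordinate. *)
Lemma box_compact n r (Good : (vec -> Prop) -> Prop) :
  0 <= r ->
  (forall S S' : vec -> Prop, (forall x, S x -> S' x) -> Good S' -> Good S) ->
  (forall S S' : vec -> Prop, Good S -> Good S' -> Good (fun x => S x \/ S' x)) ->
  (forall t, inbox n r t -> exists d, 0 < d /\ Good (fun x => near n d x t)) ->
  Good (inbox n r).
Proof.
  intros Hr. revert Good. induction n as [|n IH]; intros Good Hsub Hcup Hloc.
  - destruct (Hloc (fun _ => 0)) as (d & _ & H); [intros i Hi; lia|].
    apply Hsub with (2 := H). intros x _ i Hi. lia.
  - assert (slab : forall s, Rabs s <= r -> exists d, 0 < d /\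
      Good (fun x => Rabs (x n - s) < d /\ inbox n r x)).
    { intros s Hs.
      (* The induction hypothesis is used for another notion of goodness, that of a slab over [S];
         this is why [Good] is an arbitrary property of sets. *)
      apply (IH (fun S => exists d, 0 < d /\ Good (fun x => Rabs (x n - s) < d /\ S x))).
      - intros S S' HS (d & Hd & HG). exists d; split; [exact Hd|].
        apply Hsub with (2 := HG). intros x (Hx & HSx). auto.
      - intros S S' (d & Hd & HG) (d' & Hd' & HG'). exists (Rmin d d').
        split; [now apply Rmin_pos|].
        apply Hsub with (2 := Hcup _ _ HG HG'). intros x (Hx & [HSx|HSx]); [left|right];
          split; trivial; eapply Rlt_le_trans; [exact Hx | apply Rmin_l | exact Hx | apply Rmin_r].
      - intros t Ht. destruct (Hloc (set_coord t n s)) as (d & Hd & HG).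
        { intros i Hi. unfold set_coord. destruct (Nat.eqb_spec i n); [exact Hs | apply Ht; lia]. }
        exists d; split; [exact Hd|]. exists d; split; [exact Hd|].
        apply Hsub with (2 := HG). intros x (Hx & Hn) i Hi. unfold set_coord.
        destruct (Nat.eqb_spec i n) as [->|]; [exact Hx | apply Hn; lia]. }
    set (E := fun s => - r <= s <= r /\ Good (fun x => - r <= x n <= s /\ inbox n r x)).
    assert (E0 : E (- r)).
    { split; [lra|]. destruct (slab (- r)) as (d & Hd & HG).
      { rewrite Rabs_Ropp, Rabs_pos_eq; lra. }
      apply Hsub with (2 := HG). intros x (Hx & HB). split; [|exact HB].
      apply Rabs_lt_between; lra. }
    destruct (completeness E) as (m & Hub & Hlub).
    { exists r. intros s Hs. apply Hs. }
    { now exists (- r). }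
    assert (Hm : - r <= m <= r).
    { split; [now apply Hub|]. apply Hlub. intros s Hs. apply Hs. }
    destruct (slab m) as (d & Hd & HG); [now apply Rabs_le|].
    assert (exists s, E s /\ m - d < s) as (s & Hs & Hsm).
    { apply NNPP. intros C. enough (m <= m - d) by lra. apply Hlub. intros s Hs.
      apply Rnot_lt_le. intros Hlt. apply C. now exists s. }
    assert (Hmax : E (Rmin (m + d / 2) r)).
    { split.
      - split; [apply Rmin_glb; lra | apply Rmin_r].
      - apply Hsub with (2 := Hcup _ _ HG (proj2 Hs)). intros x (Hx & HB).
        assert (x n <= m + d / 2) by (eapply Rle_trans; [apply Hx | apply Rmin_l]).
        destruct (Rle_dec (x n) s); [right|left]; split; try tauto.
        apply Rabs_lt_between; lra. }
    assert (r <= m + d / 2).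
    { apply Rnot_lt_le. intros Hlt. rewrite Rmin_left in Hmax by lra.
      apply Hub in Hmax. lra. }
    rewrite Rmin_right in Hmax by lra.
    apply Hsub with (2 := proj2 Hmax). intros x Hx. split.
    + apply Rabs_le_between, Hx; lia.
    + intros i Hi. apply Hx; lia.
Qed.

(** A cover-free form of compactness: a finite union costs only the minimum of finitely many [d]. *)
Lemma box_compact_uniform n r (P : R -> vec -> Prop) :
  0 <= r ->
  (forall d d' x, d' <= d -> P d x -> P d' x) ->
  (forall t, inbox n r t -> exists d, 0 < d /\ forall x, near n d x t -> P d x) ->
  exists d, 0 < d /\ forall x, inbox n r x -> P d x.
Proof.
  intros Hr Hmono Hloc.
  apply (box_compact n r (fun S => exists d, 0 < d /\ forall x, S x -> P d x) Hr).
  - intros S S' HS (d & Hd & H). exists d; split; auto.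
  - intros S S' (d & Hd & H) (d' & Hd' & H'). exists (Rmin d d').
    split; [now apply Rmin_pos|].
    intros x [Hx|Hx]; eapply Hmono; [apply Rmin_l | now apply H | apply Rmin_r | now apply H'].
  - intros t Ht. destruct (Hloc t Ht) as (d & Hd & H). exists d; split; [exact Hd|].
    exists d; split; auto.
Qed.

(** * Continuity in the first n coordinates *)

(** Closeness is coordinatewise rather than in [normv], which suits induction on the dimension. *)
Definition contn (n : nat) (F : vec -> R) : Prop :=
  forall x eps, 0 < eps -> exists d, 0 < d /\
    forall y, near n d y x -> Rabs (F y - F x) < eps.

(** Vectors that agree in the first n coordinates are [near] at every scale. *)
Lemma contn_depends n F : contn n F -> depends_on_first n F.
Proof.
  intros HF x y Hxy. apply NNPP. intros Hne.
  assert (Hp : 0 < Rabs (F y - F x)) by (apply Rabs_pos_lt; lra).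
  destruct (HF x _ Hp) as (d & Hd & H).
  enough (Rabs (F y - F x) < Rabs (F y - F x)) by lra.
  apply H. intros i Hi. now rewrite (Hxy i Hi), Rminus_diag, Rabs_R0.
Qed.

Lemma contn_const n c : contn n (fun _ => c).
Proof. intros x eps He. exists 1. split; [lra|]. intros. now rewrite Rminus_diag, Rabs_R0. Qed.

Lemma contn_coord n i : (i < n)%nat -> contn n (fun x => x i).
Proof. intros Hi x eps He. exists eps. split; [exact He|]. intros y Hy. now apply Hy. Qed.

Lemma contn_comp n F (g : R -> R) :
  contn n F -> (forall x, continuity_pt g (F x)) -> contn n (fun x => g (F x)).
Proof.
  intros HF Hg x eps He.
  destruct (Hg x eps He) as (d & Hd & H).
  destruct (HF x d Hd) as (d' & Hd' & H'). exists d'. split; [exact Hd'|].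
  intros y Hy. specialize (H' y Hy).
  destruct (Req_dec (F x) (F y)) as [E|E]; [rewrite E, Rminus_diag, Rabs_R0; lra|].
  apply (H (F y)). split; [split; [exact I | exact E] | exact H'].
Qed.

Lemma contn_plus n F G : contn n F -> contn n G -> contn n (fun x => F x + G x).
Proof.
  intros HF HG x eps He.
  destruct (HF x (eps / 2)) as (d & Hd & H); [lra|].
  destruct (HG x (eps / 2)) as (d' & Hd' & H'); [lra|].
  exists (Rmin d d'). split; [now apply Rmin_pos|]. intros y Hy.
  specialize (H y (near_mono _ _ _ _ _ (Rmin_l _ _) Hy)).
  specialize (H' y (near_mono _ _ _ _ _ (Rmin_r _ _) Hy)).
  replace (F y + G y - (F x + G x)) with ((F y - F x) + (G y - G x)) by ring.
  eapply Rle_lt_trans; [apply Rabs_triang | lra].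
Qed.

Lemma contn_scal n c F : contn n F -> contn n (fun x => c * F x).
Proof.
  intros HF. apply (contn_comp n F (fun t => c * t) HF). intros x.
  apply continuity_pt_scal, continuity_pt_id.
Qed.

Lemma contn_sqr n F : contn n F -> contn n (fun x => F x ^ 2).
Proof.
  intros HF. apply (contn_comp n F (fun t => t ^ 2) HF). intros x.
  apply derivable_continuous_pt, derivable_pt_pow.
Qed.

Lemma contn_ext n F G : (forall x, F x = G x) -> contn n F -> contn n G.
Proof. intros H HF x eps He. destruct (HF x eps He) as (d & Hd & K). exists d.
  split; [exact Hd|]. intros y Hy. rewrite <- !H. now apply K. Qed.

Lemma contn_mult n F G : contn n F -> contn n G -> contn n (fun x => F x * G x).
Proof.
  intros HF HG.
  (* Polarization reduces products to squares, which are compositions with a function of one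
     variable. *)
  apply contn_ext with (fun x => / 4 * ((F x + G x) ^ 2 + - 1 * (F x + -1 * G x) ^ 2)).
  - intros x. field.
  - apply contn_scal, contn_plus; [|apply contn_scal]; apply contn_sqr, contn_plus;
      trivial; now apply contn_scal.
Qed.

Lemma contn_sum n m (F : nat -> vec -> R) :
  (forall i, (i < m)%nat -> contn n (F i)) -> contn n (fun x => sumR m (fun i => F i x)).
Proof.
  induction m as [|m IH]; intros H; simpl; [apply contn_const|].
  apply contn_plus; [apply IH; intros; apply H | apply H]; lia.
Qed.

Lemma contn_exp n F : contn n F -> contn n (fun x => exp (F x)).
Proof.
  intros HF. apply (contn_comp n F exp HF). intros x.
  apply derivable_continuous_pt, derivable_pt_exp.
Qed.

Lemma contn_shift n F m : contn n F -> contn n (fun x => F (vsub x m)).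
Proof.
  intros HF x eps He. destruct (HF (vsub x m) eps He) as (d & Hd & H).
  exists d; split; [exact Hd|]. intros y Hy. apply H. intros i Hi. unfold vsub.
  replace (y i - m i - (x i - m i)) with (y i - x i) by ring. now apply Hy.
Qed.

(** Only [x] is confined to the box. The point [y] may leave it, as it does when magnetizations are
    compared with integration points. *)
Lemma contn_unif_on_box n r F : 0 <= r -> contn n F -> forall eps, 0 < eps ->
  exists d, 0 < d /\ forall x, inbox n r x -> forall y, near n d y x -> Rabs (F y - F x) < eps.
Proof.
  intros Hr HF eps He.
  apply (box_compact_uniform n r
    (fun d x => forall y, near n d y x -> Rabs (F y - F x) < eps) Hr).
  - intros d d' x Hd H y Hy. apply H. now apply near_mono with d'.
  - intros t _. destruct (HF t (eps / 2)) as (d & Hd & H); [lra|].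
    exists (d / 2). split; [lra|]. intros x Hx y Hy.
    assert (H1 : Rabs (F x - F t) < eps / 2) by (apply H; apply near_mono with (d / 2); [lra|exact Hx]).
    assert (H2 : Rabs (F y - F t) < eps / 2).
    { apply H. intros i Hi. specialize (Hx i Hi). specialize (Hy i Hi).
      apply Rabs_lt_between in Hx, Hy. apply Rabs_lt_between. lra. }
    apply Rabs_lt_between in H1, H2. apply Rabs_lt_between. lra.
Qed.

(** * Lattice sums in several variables *)

Definition vcons (t : R) (x : vec) : vec := fun i => match i with O => t | S j => x j end.
Definition vtl (x : vec) : vec := fun i => x (S i).

Fixpoint wt (n : nat) (x : vec) : R :=
  match n with O => 1 | S m => w1 (x O) * wt m (vtl x) end.

Lemma wt_vcons n t x : wt (S n) (vcons t x) = w1 t * wt n x.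
Proof. reflexivity. Qed.

Lemma wt_pos n x : 0 < wt n x.
Proof. revert x; induction n; intros x; simpl; [lra|]. apply Rmult_lt_0_compat; [apply w1_pos | apply IHn]. Qed.

Lemma wt_le_1 n x : wt n x <= 1.
Proof.
  revert x; induction n as [|n IH]; intros x; simpl; [lra|].
  pose proof (IH (vtl x)). pose proof (wt_pos n (vtl x)).
  pose proof (w1_pos (x O)). pose proof (w1_le_1 (x O)). nra.
Qed.

Lemma wt_shift n x y : near n 1 x y -> wt n x <= 3 ^ n * wt n y.
Proof.
  revert x y; induction n as [|n IH]; intros x y H; simpl; [lra|].
  assert (w1 (x O) <= 3 * w1 (y O)) by (apply w1_shift; left; apply H; lia).
  assert (wt n (vtl x) <= 3 ^ n * wt n (vtl y)).
  { apply IH. intros i Hi. apply H. lia. }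
  replace (3 * 3 ^ n * (w1 (y 0%nat) * wt n (vtl y)))
    with ((3 * w1 (y O)) * (3 ^ n * wt n (vtl y))) by ring.
  apply Rmult_le_compat; trivial; left; [apply w1_pos | apply wt_pos].
Qed.

Lemma wt_outside n r x : 0 <= r -> ~ inbox n r x -> wt n x <= / (1 + r ^ 2).
Proof.
  intros Hr. revert x; induction n as [|n IH]; intros x H; simpl.
  - elim H. intros i Hi; lia.
  - pose proof (wt_pos n (vtl x)). pose proof (wt_le_1 n (vtl x)).
    pose proof (w1_pos (x O)). pose proof (w1_le_1 (x O)).
    change (w1 (x O) * wt n (vtl x) <= / (1 + r ^ 2)).
    destruct (Rle_dec (Rabs (x O)) r) as [Hx|Hx].
    + assert (wt n (vtl x) <= / (1 + r ^ 2)).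
      { apply IH. intros C. apply H. intros [|i] Hi; [exact Hx | apply C; lia]. }
      rewrite <- (Rmult_1_l (/ (1 + r ^ 2))). apply Rmult_le_compat; lra.
    + assert (w1 (x O) <= / (1 + r ^ 2)) by (apply w1_far; lra).
      rewrite <- (Rmult_1_r (/ (1 + r ^ 2))). apply Rmult_le_compat; lra.
Qed.

Lemma wt_inside n r x : inbox n r x -> (/ (1 + r ^ 2)) ^ n <= wt n x.
Proof.
  revert x; induction n as [|n IH]; intros x H; simpl; [lra|].
  assert (0 < 1 + r ^ 2) by nra.
  apply Rmult_le_compat.
  - left; now apply Rinv_0_lt_compat.
  - apply pow_le. left; now apply Rinv_0_lt_compat.
  - unfold w1. apply Rinv_le_contravar; [nra|].
    specialize (H O (Nat.lt_0_succ _)). rewrite <- (pow2_abs (x O)).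
    pose proof (Rabs_pos (x O)). nra.
  - apply IH. intros i Hi. apply H; lia.
Qed.

(** An iterated sum peeling off coordinate 0. Coordinates from n on are set to 0, which is harmless
    for functions of the first n coordinates. *)
Fixpoint msum (n : nat) (h a : vec) (K : nat) (F : vec -> R) : R :=
  match n with
  | O => F (fun _ => 0)
  | S m => lsum (h O) (a O) K (fun t => msum m (vtl h) (vtl a) K (fun x => F (vcons t x)))
  end.

Lemma msum_ext n h a K F G : (forall x, F x = G x) -> msum n h a K F = msum n h a K G.
Proof. intros H. f_equal. now apply functional_extensionality. Qed.

Lemma msum_plus n h a K F G :
  msum n h a K (fun x => F x + G x) = msum n h a K F + msum n h a K G.
Proof.
  revert h a F G; induction n as [|n IH]; intros h a F G; simpl; [reflexivity|].
  rewrite <- lsum_plus. apply lsum_ext. intros t. now rewrite <- IH.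
Qed.

Lemma msum_scal n h a K c F : msum n h a K (fun x => c * F x) = c * msum n h a K F.
Proof.
  revert h a F; induction n as [|n IH]; intros h a F; simpl; [reflexivity|].
  rewrite <- lsum_scal. apply lsum_ext. intros t. now rewrite <- IH.
Qed.

Lemma msum_le n h a K F G : (forall i, (i < n)%nat -> 0 < h i) ->
  (forall x, F x <= G x) -> msum n h a K F <= msum n h a K G.
Proof.
  revert h a F G; induction n as [|n IH]; intros h a F G Hh H; simpl; [apply H|].
  apply lsum_le; [left; apply Hh; lia|]. intros t. apply IH; [|intros; apply H].
  intros i Hi. apply Hh; lia.
Qed.

Lemma msum_Rabs n h a K B F : (forall i, (i < n)%nat -> 0 < h i <= 1) ->
  (forall x, Rabs (F x) <= B * wt n x) -> Rabs (msum n h a K F) <= (3 * PI) ^ n * B.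
Proof.
  revert h a B F; induction n as [|n IH]; intros h a B F Hh H; simpl.
  - specialize (H (fun _ => 0)). simpl in H. lra.
  - rewrite Rmult_assoc. apply lsum_Rabs_w1; [apply Hh; lia|]. intros t.
    rewrite Rmult_assoc. apply IH; [intros i Hi; apply Hh; lia|].
    intros x. specialize (H (vcons t x)). simpl in H.
    rewrite Rmult_assoc. exact H.
Qed.

(** The lattices that count as fine and large: mesh below [d], and nodes reaching past - r and r in
    each coordinate even after the shift by [a]. *)
Definition adm (n : nat) (d r : R) (h a : vec) (K : nat) : Prop :=
  forall i, (i < n)%nat -> 0 < h i < d /\ Rabs (a i) + r <= INR K * h i.

Lemma adm_mono n d r d' r' h a K : d <= d' -> r' <= r -> adm n d r h a K -> adm n d' r' h a K.
Proof. intros Hd Hr H i Hi. specialize (H i Hi). lra. Qed.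

Lemma adm_tl n d r h a K : adm (S n) d r h a K -> adm n d r (vtl h) (vtl a) K.
Proof. intros H i Hi. apply (H (S i)). lia. Qed.

(** Uniform continuity with a modulus that decays like the weight, so that it can be summed over
    arbitrarily many cells. *)
Definition unifw (n : nat) (F : vec -> R) : Prop :=
  forall eps, 0 < eps -> exists d, 0 < d /\
    forall x y, near n d x y -> Rabs (F x - F y) <= eps * wt n y.

(** The first term sums the error of the inner n-fold sums over the outer variable; the second is
    the error of the outer sum, for a function bounded by means of (3 * PI) ^ n. *)
Fixpoint cauchy_const (n : nat) : R :=
  match n with O => 0 | S m => 3 * PI * cauchy_const m + 6 * PI * (3 * PI) ^ m end.

Lemma cauchy_const_nonneg n : 0 <= cauchy_const n.
Proof.
  pose proof PI_RGT_0. induction n as [|n IH]; simpl; [lra|].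
  assert (0 < (3 * PI) ^ n) by (apply pow_lt; lra).
  assert (0 <= 3 * PI * cauchy_const n) by (apply Rmult_le_pos; lra).
  assert (0 < 6 * PI * (3 * PI) ^ n) by (apply Rmult_lt_0_compat; lra). lra.
Qed.

Lemma near_vcons n d s t x : 0 < d -> Rabs (s - t) < d -> near (S n) d (vcons s x) (vcons t x).
Proof.
  intros Hd H [|i] Hi; simpl; [exact H|]. now rewrite Rminus_diag, Rabs_R0.
Qed.

Lemma msum_cauchy n F A eta d r h a K h' a' K' :
  (forall x, Rabs (F x) <= A * wt n x ^ 2) ->
  0 < d <= 1 -> 0 <= r -> 0 <= eta ->
  (forall x y, near n d x y -> Rabs (F x - F y) <= eta * wt n y) ->
  unifw n F -> adm n d r h a K -> adm n d r h' a' K' ->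
  Rabs (msum n h a K F - msum n h' a' K' F) <= cauchy_const n * (eta + A / (1 + r ^ 2)).
Proof.
  intros HA Hd Hr. pose proof PI_RGT_0 as HPI.
  revert F A eta h a h' a' HA.
  induction n as [|n IH]; intros F A eta h a h' a' HA Heta HF HU Hadm Hadm'.
  - simpl. rewrite Rminus_diag, Rabs_R0. lra.
  - assert (HA0 : 0 <= A).
    { specialize (HA (fun _ => 0)). pose proof (Rabs_pos (F (fun _ => 0))).
      pose proof (pow_lt _ 2 (wt_pos (S n) (fun _ => 0))). nra. }
    assert (Hr2 : 0 < / (1 + r ^ 2)) by (apply Rinv_0_lt_compat; nra).
    pose proof (cauchy_const_nonneg n) as HC.
    assert (Hpow : 0 < (3 * PI) ^ n) by (apply pow_lt; lra).
    assert (Hh' : forall i, (i < n)%nat -> 0 < vtl h' i <= 1).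
    { intros i Hi. specialize (Hadm' (S i) (ltac:(lia))). unfold vtl. lra. }
    set (G := fun t => msum n (vtl h) (vtl a) K (fun x => F (vcons t x))).
    set (G' := fun t => msum n (vtl h') (vtl a') K' (fun x => F (vcons t x))).
    change (Rabs (lsum (h O) (a O) K G - lsum (h' O) (a' O) K' G')
      <= cauchy_const (S n) * (eta + A / (1 + r ^ 2))).
    (* First the inner lattice is changed under a fixed outer one. The induction hypothesis is
       applied to the slice at t with constants eta * w1 t and A * w1 t ^ 2, so the resulting error
       is summable in t. *)
    assert (H1 : Rabs (lsum (h O) (a O) K (fun t => G t + -1 * G' t))
       <= 3 * PI * (cauchy_const n * (eta + A / (1 + r ^ 2)))).
    { apply lsum_Rabs_w1; [specialize (Hadm O (ltac:(lia))); lra|].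
      intros t. pose proof (w1_pos t). pose proof (w1_le_1 t).
      apply Rle_trans with (cauchy_const n * (eta * w1 t + A * w1 t ^ 2 / (1 + r ^ 2))).
      - replace (G t + -1 * G' t) with (G t - G' t) by ring. apply IH.
        + intros x. specialize (HA (vcons t x)). rewrite wt_vcons in HA.
          eapply Rle_trans; [exact HA|]. right. ring.
        + apply Rmult_le_pos; lra.
        + intros x y Hxy. rewrite Rmult_assoc. apply HF.
          intros [|i] Hi; simpl; [rewrite Rminus_diag, Rabs_R0; lra | apply Hxy; lia].
        + intros eps He. destruct (HU eps He) as (d' & Hd' & H'). exists d'. split; [exact Hd'|].
          intros x y Hxy. eapply Rle_trans; [apply H'|].
          * intros [|i] Hi; simpl; [rewrite Rminus_diag, Rabs_R0; lra | apply Hxy; lia].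
          * simpl. apply Rmult_le_compat_l; [lra|]. pose proof (wt_pos n (vtl (vcons t y))).
            change (wt n y) with (wt n (vtl (vcons t y))). nra.
        + now apply adm_tl.
        + now apply adm_tl.
      - rewrite Rmult_assoc. apply Rmult_le_compat_l; [exact HC|].
        unfold Rdiv. assert (w1 t ^ 2 <= w1 t) by nra.
        assert (A * w1 t ^ 2 * / (1 + r ^ 2) <= A * w1 t * / (1 + r ^ 2)).
        { apply Rmult_le_compat_r; [lra|]. now apply Rmult_le_compat_l. }
        lra. }
    assert (Gdiff : forall e d', 0 < d' ->
      (forall x y, near (S n) d' x y -> Rabs (F x - F y) <= e * wt (S n) y) ->
      forall s t, Rabs (s - t) < d' -> Rabs (G' s - G' t) <= (3 * PI) ^ n * (e * w1 t)).
    { intros e d' Hd' He s t Hst. unfold G'.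
      replace (msum n (vtl h') (vtl a') K' (fun x => F (vcons s x)) -
               msum n (vtl h') (vtl a') K' (fun x => F (vcons t x)))
        with (msum n (vtl h') (vtl a') K' (fun x => F (vcons s x) + -1 * F (vcons t x)))
        by (rewrite msum_plus, msum_scal; ring).
      apply msum_Rabs; [exact Hh'|]. intros x. rewrite Rmult_assoc.
      replace (F (vcons s x) + -1 * F (vcons t x)) with (F (vcons s x) - F (vcons t x)) by ring.
      apply He. now apply near_vcons. }
    assert (H2 : Rabs (lsum (h O) (a O) K G' - lsum (h' O) (a' O) K' G')
       <= 6 * PI * ((3 * PI) ^ n * eta) + 4 * PI * ((3 * PI) ^ n * A / (1 + r ^ 2))).
    { destruct (Hadm O (ltac:(lia))). destruct (Hadm' O (ltac:(lia))).
      (* Here the modulus is required on a closed range of distances, while [near] is strict; the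
         larger of the two meshes is still strictly below [d]. *)
      apply lsum_cauchy with (delta := Rmax (h O) (h' O)); try lra.
      - intros t eps He.
        destruct (HU (eps / (2 * (3 * PI) ^ n))) as (d' & Hd' & H').
        { apply Rdiv_lt_0_compat; lra. }
        exists d'. split; [exact Hd'|]. intros s (_ & Hs).
        change (Rabs (G' s - G' t) < eps). change (Rabs (s - t) < d') in Hs.
        eapply Rle_lt_trans; [apply (Gdiff _ d' Hd' H' s t Hs)|].
        pose proof (w1_le_1 t). pose proof (w1_pos t).
        replace ((3 * PI) ^ n * (eps / (2 * (3 * PI) ^ n) * w1 t)) with (eps / 2 * w1 t)
          by (field; lra).
        apply Rle_lt_trans with (eps / 2 * 1); [apply Rmult_le_compat_l|]; lra.
      - intros t. unfold G'. rewrite Rmult_assoc. apply msum_Rabs; [exact Hh'|].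
        intros x. specialize (HA (vcons t x)). rewrite wt_vcons in HA.
        pose proof (wt_pos n x). pose proof (wt_le_1 n x).
        eapply Rle_trans; [exact HA|]. rewrite Rmult_assoc.
        apply Rmult_le_compat_l; [exact HA0|].
        pose proof (pow_lt _ 2 (w1_pos t)).
        replace ((w1 t * wt n x) ^ 2) with (w1 t ^ 2 * (wt n x * wt n x)) by ring.
        apply Rmult_le_compat_l; [lra|]. nra.
      - intros s t Hst. rewrite Rmult_assoc. apply Gdiff with d; [lra | exact HF |].
        eapply Rle_lt_trans; [exact Hst|]. apply Rmax_lub_lt; lra.
      - apply Rmax_l.
      - apply Rmax_r. }
    rewrite lsum_plus, lsum_scal in H1.
    assert (HQ : 0 <= A / (1 + r ^ 2)) by (apply Rmult_le_pos; lra).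
    assert (0 <= PI * ((3 * PI) ^ n * (A / (1 + r ^ 2)))).
    { apply Rmult_le_pos; [lra|]. apply Rmult_le_pos; lra. }
    replace ((3 * PI) ^ n * A / (1 + r ^ 2)) with ((3 * PI) ^ n * (A / (1 + r ^ 2))) in H2
      by (unfold Rdiv; ring).
    change (cauchy_const (S n)) with (3 * PI * cauchy_const n + 6 * PI * (3 * PI) ^ n).
    set (q := A / (1 + r ^ 2)) in *. set (p := (3 * PI) ^ n) in *.
    apply Rabs_le_between in H1, H2. apply Rabs_le. nra.
Qed.
(** * Integrals over R^n as limits of lattice sums *)

(* The mesh may differ between coordinates and the lattice may be off-centre:
   this makes invariance under diagonal scaling and under translation immediate. *)
Definition Int (n : nat) (F : vec -> R) (I : R) : Prop :=
  forall eps, 0 < eps -> exists d r, 0 < d /\ 0 <= r /\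
    forall h a K, adm n d r h a K -> Rabs (msum n h a K F - I) < eps.

Lemma adm_exists n d r : 0 < d -> 0 <= r -> exists h a K, adm n d r h a K.
Proof.
  intros Hd Hr. destruct (INR_unbounded (r / (d / 2))) as (K & HK).
  exists (fun _ => d / 2), (fun _ => 0), K. intros i _. rewrite Rabs_R0. split; [lra|].
  apply Rmult_gt_compat_r with (r := d / 2) in HK; [|lra].
  replace (r / (d / 2) * (d / 2)) with r in HK by (field; lra). lra.
Qed.

Lemma Int_pair n F G I I' eps : Int n F I -> Int n G I' -> 0 < eps ->
  exists h a K, (forall i, (i < n)%nat -> 0 < h i <= 1) /\
    Rabs (msum n h a K F - I) < eps /\ Rabs (msum n h a K G - I') < eps.
Proof.
  intros HF HG He. destruct (HF eps He) as (d & r & Hd & Hr & H).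
  destruct (HG eps He) as (d' & r' & Hd' & Hr' & H').
  destruct (adm_exists n (Rmin 1 (Rmin d d')) (Rmax r r')) as (h & a & K & Hadm).
  - repeat apply Rmin_pos; lra.
  - eapply Rle_trans; [exact Hr | apply Rmax_l].
  - pose proof (Rmin_l 1 (Rmin d d')). pose proof (Rmin_r 1 (Rmin d d')).
    pose proof (Rmin_l d d'). pose proof (Rmin_r d d').
    exists h, a, K. split; [|split].
    + intros i Hi. specialize (Hadm i Hi). lra.
    + apply H. apply adm_mono with (3 := Hadm); [lra | apply Rmax_l].
    + apply H'. apply adm_mono with (3 := Hadm); [lra | apply Rmax_r].
Qed.

Lemma Int_le n F G I I' : Int n F I -> Int n G I' -> (forall x, F x <= G x) -> I <= I'.
Proof.
  intros HF HG Hle. apply Rnot_lt_le. intros Hlt.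
  destruct (Int_pair n F G I I' ((I - I') / 2) HF HG) as (h & a & K & Hh & H1 & H2); [lra|].
  assert (msum n h a K F <= msum n h a K G).
  { apply msum_le; [intros; now apply Hh | exact Hle]. }
  apply Rabs_lt_between in H1, H2. lra.
Qed.

Lemma Int_unique n F I I' : Int n F I -> Int n F I' -> I = I'.
Proof. intros H H'. apply Rle_antisym; eapply Int_le; eauto; intros; lra. Qed.

Lemma Int_ext n F G I : (forall x, F x = G x) -> Int n F I -> Int n G I.
Proof.
  intros H. replace G with F; [easy|]. now apply functional_extensionality.
Qed.

Lemma Int_plus n F G I I' : Int n F I -> Int n G I' -> Int n (fun x => F x + G x) (I + I').
Proof.
  intros HF HG eps He. destruct (HF (eps / 2)) as (d & r & Hd & Hr & H); [lra|].
  destruct (HG (eps / 2)) as (d' & r' & Hd' & Hr' & H'); [lra|].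
  exists (Rmin d d'), (Rmax r r'). split; [now apply Rmin_pos|]. split.
  - eapply Rle_trans; [exact Hr | apply Rmax_l].
  - intros h a K Hadm. rewrite msum_plus.
    specialize (H h a K (adm_mono _ _ _ _ _ _ _ _ (Rmin_l _ _) (Rmax_l _ _) Hadm)).
    specialize (H' h a K (adm_mono _ _ _ _ _ _ _ _ (Rmin_r _ _) (Rmax_r _ _) Hadm)).
    apply Rabs_lt_between in H, H'. apply Rabs_lt_between. lra.
Qed.

Lemma Int_scal n c F I : Int n F I -> Int n (fun x => c * F x) (c * I).
Proof.
  intros HF eps He. pose proof (Rabs_pos c) as Hc.
  destruct (HF (eps / (Rabs c + 1))) as (d & r & Hd & Hr & H).
  { apply Rdiv_lt_0_compat; lra. }
  exists d, r. repeat split; trivial. intros h a K Hadm. rewrite msum_scal.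
  rewrite <- Rmult_minus_distr_l, Rabs_mult. specialize (H h a K Hadm).
  pose proof (Rabs_pos (msum n h a K F - I)).
  apply Rle_lt_trans with ((Rabs c + 1) * Rabs (msum n h a K F - I)); [nra|].
  apply Rmult_lt_compat_l with (r := Rabs c + 1) in H; [|lra].
  replace ((Rabs c + 1) * (eps / (Rabs c + 1))) with eps in H by (field; lra). exact H.
Qed.

Lemma Int_zero n : Int n (fun _ => 0) 0.
Proof.
  intros eps He. exists 1, 0. repeat split; try lra. intros h a K _.
  rewrite (msum_ext n h a K (fun _ => 0) (fun x => 0 * 0)) by (intros; ring).
  rewrite msum_scal, Rmult_0_l, Rminus_diag, Rabs_R0. exact He.
Qed.

Lemma Int_sum n m (F : nat -> vec -> R) (I : nat -> R) :
  (forall p, (p < m)%nat -> Int n (F p) (I p)) ->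
  Int n (fun x => sumR m (fun p => F p x)) (sumR m I).
Proof.
  induction m as [|m IH]; intros H; simpl; [apply Int_zero|].
  apply Int_plus; [apply IH; intros; apply H | apply H]; lia.
Qed.

Lemma Int_Rabs_le n F G I I' : Int n F I -> Int n G I' ->
  (forall x, Rabs (F x) <= G x) -> Rabs I <= I'.
Proof.
  intros HF HG H. apply Rabs_le. split.
  - enough (-1 * I' <= I) by lra. apply (Int_le n _ _ _ _ (Int_scal n (-1) _ _ HG) HF).
    intros x. specialize (H x). apply Rabs_le_between in H. lra.
  - apply (Int_le n _ _ _ _ HF HG). intros x. specialize (H x).
    apply Rabs_le_between in H. lra.
Qed.

(** * Diagonal scaling and translation of the integral *)

Lemma msum_diag_scale n h a K F lam : (forall i, (i < n)%nat -> 0 < lam i) ->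
  msum n h a K (fun x => F (fun i => lam i * x i))
  = / prodR n lam * msum n (fun i => lam i * h i) (fun i => lam i * a i) K F.
Proof.
  revert h a F lam; induction n as [|n IH]; intros h a F lam Hl.
  - simpl. rewrite Rinv_1, Rmult_1_l. f_equal. apply functional_extensionality; intros; ring.
  - rewrite prodR_first. simpl msum.
    assert (0 < lam O) by (apply Hl; lia).
    assert (0 < prodR n (fun i => lam (S i))) by (apply prodR_pos; intros; apply Hl; lia).
    unfold lsum. transitivity (h O * (/ prodR n (fun i => lam (S i)) *
      sumR (2 * K + 1) (fun j => msum n (vtl (fun i => lam i * h i)) (vtl (fun i => lam i * a i)) K
        (fun x => F (vcons (lam O * a O + (INR j - INR K) * (lam O * h O)) x))))).
    2: { rewrite Rinv_mult. field. lra. }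
    f_equal. rewrite <- sumR_scal. apply sumR_ext. intros j _.
    set (c := lam O * a O + (INR j - INR K) * (lam O * h O)).
    transitivity (msum n (vtl h) (vtl a) K (fun x => F (vcons c (fun i => vtl lam i * x i)))).
    + apply msum_ext. intros x. f_equal. apply functional_extensionality.
      intros [|i]; unfold c; simpl; [ring | reflexivity].
    + apply (IH (vtl h) (vtl a) (fun y => F (vcons c y)) (vtl lam)).
      intros i Hi. apply Hl; lia.
Qed.

Lemma Int_diag_scale n F I lam : (forall i, (i < n)%nat -> 0 < lam i) -> Int n F I ->
  Int n (fun x => F (fun i => lam i * x i)) (/ prodR n lam * I).
Proof.
  intros Hl HF eps He. pose proof (prodR_pos n lam Hl) as Hp.
  destruct (HF (prodR n lam * eps)) as (d & r & Hd & Hr & H); [now apply Rmult_lt_0_compat|].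
  destruct (finite_upper_bound n lam) as (M & HM & HlM).
  destruct (finite_lower_bound n lam Hl) as (m & Hm & Hlm).
  (* Scaling multiplies a mesh by at most [M] and the covered radius by at least [m]. *)
  exists (d / M), (r / m).
  split; [now apply Rdiv_lt_0_compat|].
  split; [apply Rmult_le_pos; [exact Hr | left; now apply Rinv_0_lt_compat]|].
  intros h a K Hadm. rewrite msum_diag_scale by exact Hl.
  rewrite <- Rmult_minus_distr_l, Rabs_mult, Rabs_pos_eq
    by (left; now apply Rinv_0_lt_compat).
  apply Rmult_lt_reg_l with (prodR n lam); [exact Hp|].
  rewrite <- Rmult_assoc, Rinv_r, Rmult_1_l by lra.
  apply H. intros i Hi. destruct (Hadm i Hi) as ((H1 & H2) & H3).
  specialize (Hl i Hi). specialize (HlM i Hi). specialize (Hlm i Hi). split; [split|].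
  - now apply Rmult_lt_0_compat.
  - apply Rle_lt_trans with (M * h i); [apply Rmult_le_compat_r; lra|].
    apply Rmult_lt_reg_l with (/ M); [now apply Rinv_0_lt_compat|].
    rewrite <- Rmult_assoc, Rinv_l, Rmult_1_l by lra. unfold Rdiv in H2. lra.
  - rewrite Rabs_mult, (Rabs_pos_eq (lam i)) by lra.
    assert (r <= lam i * (r / m)).
    { apply Rle_trans with (m * (r / m)); [right; field; lra|].
      apply Rmult_le_compat_r; [|exact Hlm].
      apply Rmult_le_pos; [exact Hr | left; now apply Rinv_0_lt_compat]. }
    nra.
Qed.

Lemma msum_translate n h a K F b : depends_on_first n F ->
  msum n h a K (fun x => F (vsub x b)) = msum n h (vsub a b) K F.
Proof.
  revert h a F b; induction n as [|n IH]; intros h a F b HF; simpl.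
  - apply HF. intros i Hi; lia.
  - unfold lsum. f_equal. apply sumR_ext. intros j _.
    set (c := vsub a b O + (INR j - INR K) * h O).
    transitivity (msum n (vtl h) (vtl a) K (fun x => F (vcons c (vsub x (vtl b))))).
    + apply msum_ext. intros x. f_equal. apply functional_extensionality.
      intros [|i]; unfold c, vsub; simpl; [ring | reflexivity].
    + apply (IH (vtl h) (vtl a) (fun y => F (vcons c y)) (vtl b)).
      intros x y Hxy. apply HF.
      intros [|i] Hi; simpl; [reflexivity | apply Hxy; lia].
Qed.

Lemma Int_translate n F I b : depends_on_first n F -> Int n F I ->
  Int n (fun x => F (vsub x b)) I.
Proof.
  intros HF HI eps He. destruct (HI eps He) as (d & r & Hd & Hr & H).
  destruct (finite_upper_bound n (fun i => Rabs (b i))) as (M & HM & Hb).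
  (* Translation moves the centre of the lattice by at most [M] in each coordinate. *)
  exists d, (r + M). repeat split; [exact Hd | lra |].
  intros h a K Hadm. rewrite msum_translate by exact HF. apply H.
  intros i Hi. destruct (Hadm i Hi) as (H1 & H2). split; [exact H1|].
  specialize (Hb i Hi). unfold vsub.
  pose proof (Rabs_triang (a i) (- b i)) as Ht. rewrite Rabs_Ropp in Ht. unfold Rminus. lra.
Qed.

(** * Positivity of the integral *)

Lemma msum_lower_bound n F c rho h a K q :
  (forall x, 0 <= F x) -> 0 <= c -> 0 < rho -> (forall x, inbox n rho x -> c <= F x) ->
  (forall i, (i < n)%nat -> 0 < h i /\ h i * INR q = rho /\ a i = 0) -> (q <= K)%nat ->
  c * rho ^ n <= msum n h a K F.
Proof.
  intros HF Hc Hrho. revert F h a HF. induction n as [|n IH]; intros F h a HF HFc Hh HqK.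
  - simpl. rewrite Rmult_1_r. apply HFc. intros i Hi; lia.
  - destruct (Hh O (Nat.lt_0_succ _)) as (h0 & hq & a0). simpl.
    set (G := fun t => msum n (vtl h) (vtl a) K (fun x => F (vcons t x))).
    change (c * (rho * rho ^ n) <= lsum (h O) (a O) K G).
    assert (Hh' : forall i, (i < n)%nat -> 0 < vtl h i /\ vtl h i * INR q = rho /\ vtl a i = 0)
      by (intros i Hi; apply (Hh (S i)); lia).
    assert (G0 : forall t, 0 <= G t).
    { intros t. apply Rle_trans with (msum n (vtl h) (vtl a) K (fun x => 0 * 0)).
      - rewrite msum_scal; lra.
      - apply msum_le; [intros; now apply Hh'|]. intros x. rewrite Rmult_0_l. apply HF. }
    assert (Gc : forall t, Rabs t <= rho -> c * rho ^ n <= G t).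
    { intros t Ht. apply IH; [intros; apply HF | | exact Hh' | exact HqK].
      intros x Hx. apply HFc. intros [|i] Hi; simpl; [exact Ht | apply Hx; lia]. }
    (* The q nodes from index K on are 0, h, ..., (q - 1) h and lie in [0, rho]; they alone give c *
       rho ^ n, since h q = rho. The nodes before and after contribute nonnegative amounts. *)
    unfold lsum. replace (2 * K + 1)%nat with (K + (q + (K - q + 1)))%nat by lia.
    rewrite (sumR_add K), (sumR_add q).
    assert (0 <= sumR K (fun j => G (a O + (INR j - INR K) * h O)))
      by (apply sumR_nonneg; intros; apply G0).
    assert (0 <= sumR (K - q + 1) (fun i => G (a O + (INR (K + (q + i)) - INR K) * h O)))
      by (apply sumR_nonneg; intros; apply G0).
    assert (sumR q (fun _ => c * rho ^ n) <= sumR q (fun i => G (a O + (INR (K + i) - INR K) * h O))).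
    { apply sumR_le. intros i Hi. apply Gc. rewrite a0, plus_INR.
      replace (0 + (INR K + INR i - INR K) * h O) with (INR i * h O) by ring.
      rewrite Rabs_pos_eq by (apply Rmult_le_pos; [apply pos_INR | lra]).
      rewrite <- hq, Rmult_comm. apply Rmult_le_compat_l; [lra|]. apply le_INR; lia. }
    rewrite sumR_const in H1.
    apply Rle_trans with (h O * (INR q * (c * rho ^ n))).
    + right. rewrite <- hq at 1. ring.
    + apply Rmult_le_compat_l; lra.
Qed.

Lemma Int_pos n F I c rho : Int n F I -> (forall x, 0 <= F x) -> 0 < c -> 0 < rho ->
  (forall x, inbox n rho x -> c <= F x) -> 0 < I.
Proof.
  intros HI HF Hc Hrho HFc. apply Rnot_le_lt. intros Hle.
  assert (Hp : 0 < c * rho ^ n) by (apply Rmult_lt_0_compat; [|apply pow_lt]; lra).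
  destruct (HI _ Hp) as (d & r & Hd & Hr & H).
  (* The mesh is an exact fraction rho / q of the radius, below [d]; the lower bound c * rho ^ n
     then does not depend on the mesh and contradicts I <= 0. *)
  destruct (INR_unbounded (rho / d)) as (q & Hq).
  assert (Hq0 : 0 < INR q).
  { apply Rlt_trans with (2 := Hq). now apply Rdiv_lt_0_compat. }
  assert (Hh : 0 < rho / INR q) by now apply Rdiv_lt_0_compat.
  destruct (INR_unbounded (r / (rho / INR q))) as (K & HK).
  set (h := fun _ : nat => rho / INR q). set (a := fun _ : nat => 0).
  assert (L : c * rho ^ n <= msum n h a (K + q) F).
  { apply msum_lower_bound with q; trivial; [lra | | lia].
    intros i _. unfold h, a. repeat split; [exact Hh | field; lra]. }
  assert (Hadm : adm n d r h a (K + q)).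
  { intros i _. unfold h, a. rewrite Rabs_R0. repeat split; [exact Hh| |].
    - apply Rmult_lt_reg_r with (INR q); [exact Hq0|].
      replace (rho / INR q * INR q) with rho by (field; lra).
      apply Rmult_gt_compat_r with (r := d) in Hq; [|exact Hd].
      replace (rho / d * d) with rho in Hq by (field; lra). lra.
    - apply Rmult_gt_compat_r with (r := rho / INR q) in HK; [|exact Hh].
      replace (r / (rho / INR q) * (rho / INR q)) with r in HK by (field; lra).
      rewrite plus_INR.
      assert (0 <= INR q * (rho / INR q)) by (apply Rmult_le_pos; lra). lra. }
  specialize (H h a _ Hadm). apply Rabs_lt_between in H. lra.
Qed.

(** * Existence of the integral under domination *)

Lemma small_tail_radius A eps : 0 <= A -> 0 < eps -> exists r, 0 <= r /\ A / (1 + r ^ 2) <= eps.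
Proof.
  intros HA He. exists (A / eps).
  assert (HQ : 0 <= A / eps) by (apply Rmult_le_pos; [exact HA | left; now apply Rinv_0_lt_compat]).
  split; [exact HQ|].
  set (q := A / eps) in *. assert (Hq : 0 < 1 + q ^ 2) by nra.
  assert (HAq : A = eps * q) by (unfold q; field; lra).
  apply Rmult_le_reg_r with (1 + q ^ 2); [exact Hq|].
  replace (A / (1 + q ^ 2) * (1 + q ^ 2)) with (eps * q) by (rewrite HAq; field; lra).
  apply Rmult_le_compat_l; nra.
Qed.

(** Inside a large box, uniform continuity is used with eps times the least weight there. Outside,
    both values are of order wt ^ 2, and one of the two factors is already small. The constant 9 ^ n
    is the square of the 3 ^ n of [wt_shift]. *)
Lemma contn_unifw n F A : contn n F -> (forall x, Rabs (F x) <= A * wt n x ^ 2) -> unifw n F.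
Proof.
  intros HF HA eps He.
  assert (HA0 : 0 <= A).
  { specialize (HA (fun _ => 0)). pose proof (Rabs_pos (F (fun _ => 0))).
    pose proof (pow_lt _ 2 (wt_pos n (fun _ => 0))). nra. }
  assert (H9 : 0 < 9 ^ n) by (apply pow_lt; lra).
  destruct (small_tail_radius (A * (9 ^ n + 1)) eps) as (r & Hr & Hsmall);
    [apply Rmult_le_pos; lra | exact He |].
  assert (Hw : 0 < (/ (1 + r ^ 2)) ^ n) by (apply pow_lt, Rinv_0_lt_compat; nra).
  destruct (contn_unif_on_box n r F Hr HF (eps * (/ (1 + r ^ 2)) ^ n)) as (d & Hd & H).
  { now apply Rmult_lt_0_compat. }
  exists (Rmin 1 d). split; [apply Rmin_pos; lra|]. intros x y Hxy.
  assert (Hx1 : near n 1 x y) by (apply near_mono with (2 := Hxy), Rmin_l).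
  assert (Hxd : near n d x y) by (apply near_mono with (2 := Hxy), Rmin_r).
  pose proof (wt_pos n y) as Wy. pose proof (wt_pos n x) as Wx.
  destruct (classic (inbox n r y)) as [Hy|Hy].
  - left. eapply Rlt_le_trans; [now apply (H y Hy)|].
    apply Rmult_le_compat_l; [lra | now apply wt_inside].
  - pose proof (wt_outside n r y Hr Hy) as Wo. pose proof (wt_shift n x y Hx1) as Ws.
    assert (Rabs (F x - F y) <= A * (9 ^ n + 1) * wt n y ^ 2).
    { eapply Rle_trans; [unfold Rminus; apply Rabs_triang|]. rewrite Rabs_Ropp.
      pose proof (HA x). pose proof (HA y).
      assert (A * wt n x ^ 2 <= A * (9 ^ n * wt n y ^ 2)).
      { apply Rmult_le_compat_l; [exact HA0|].
        replace (9 ^ n * wt n y ^ 2) with ((3 ^ n * wt n y) ^ 2).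
        - apply pow_incr; lra.
        - rewrite Rpow_mult_distr, <- pow_mult, Nat.mul_comm, pow_mult.
          replace (3 ^ 2) with 9 by ring. reflexivity. }
      lra. }
    eapply Rle_trans; [exact H0|].
    replace (A * (9 ^ n + 1) * wt n y ^ 2) with (A * (9 ^ n + 1) * wt n y * wt n y) by ring.
    apply Rmult_le_compat_r; [lra|]. eapply Rle_trans; [|exact Hsmall].
    apply Rmult_le_compat_l; [apply Rmult_le_pos; lra | exact Wo].
Qed.

Lemma Int_exists n F A : contn n F -> (forall x, Rabs (F x) <= A * wt n x ^ 2) ->
  exists I, Int n F I.
Proof.
  intros HF HA. pose proof (contn_unifw n F A HF HA) as HU.
  assert (HA0 : 0 <= A).
  { specialize (HA (fun _ => 0)). pose proof (Rabs_pos (F (fun _ => 0))).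
    pose proof (pow_lt _ 2 (wt_pos n (fun _ => 0))). nra. }
  pose proof (cauchy_const_nonneg n) as HC.
  assert (Cauchy : forall eps, 0 < eps -> exists d r, 0 < d /\ 0 <= r /\
    forall h a K h' a' K', adm n d r h a K -> adm n d r h' a' K' ->
      Rabs (msum n h a K F - msum n h' a' K' F) < eps).
  { intros eps He. set (e := eps / (2 * (cauchy_const n + 1))).
    assert (Hep : 0 < e) by (apply Rdiv_lt_0_compat; lra).
    destruct (HU e Hep) as (d & Hd & H).
    destruct (small_tail_radius A e HA0 Hep) as (r & Hr & Hs).
    exists (Rmin d 1), r. split; [apply Rmin_pos; lra|]. split; [exact Hr|].
    intros h a K h' a' K' Ha Ha'.
    apply Rle_lt_trans with (cauchy_const n * (e + A / (1 + r ^ 2))).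
    - apply msum_cauchy with (Rmin d 1); trivial.
      + split; [apply Rmin_pos; lra | apply Rmin_r].
      + lra.
      + intros x y Hxy. apply H. apply near_mono with (2 := Hxy), Rmin_l.
    - apply Rle_lt_trans with (cauchy_const n * (2 * e)); [apply Rmult_le_compat_l; lra|].
      replace eps with ((cauchy_const n + 1) * (2 * e)) by (unfold e; field; lra). nra. }
  (* Mesh 1 / (m + 1) with K = (m + 1) ^ 2 reaches radius m + 1, so this sequence of lattices is
     eventually admissible for every [d] and [r]. *)
  set (u := fun m => msum n (fun _ => / INR (S m)) (fun _ => 0) (S m * S m) F).
  assert (Hadm : forall d r, 0 < d -> 0 <= r -> exists M, forall m, (M <= m)%nat ->
    adm n d r (fun _ => / INR (S m)) (fun _ => 0) (S m * S m)).
  { intros d r Hd Hr. destruct (INR_unbounded (r + / d)) as (M & HM).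
    exists M. intros m Hm i _. rewrite Rabs_R0, mult_INR.
    assert (Hdi : 0 < / d) by now apply Rinv_0_lt_compat.
    assert (INR M < INR (S m)) by (apply lt_INR; lia). repeat split.
    - apply Rinv_0_lt_compat. lra.
    - rewrite <- (Rinv_inv d). apply Rinv_lt_contravar; [apply Rmult_lt_0_compat|]; lra.
    - rewrite Rmult_assoc, Rinv_r; lra. }
  destruct (Rcomplete.R_complete u) as (l & Hl).
  { intros eps He. destruct (Cauchy eps He) as (d & r & Hd & Hr & H).
    destruct (Hadm d r Hd Hr) as (M & HM). exists M. intros m m' Hm Hm'.
    apply H; apply HM; assumption. }
  exists l. intros eps He. destruct (Cauchy (eps / 2)) as (d & r & Hd & Hr & H); [lra|].
  exists d, r. repeat split; trivial. intros h a K Ha.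
  destruct (Hadm d r Hd Hr) as (M & HM).
  destruct (Hl (eps / 2)) as (M' & HM'); [lra|].
  specialize (HM' (max M M') (Nat.le_max_r _ _)). unfold Rdist in HM'.
  specialize (H _ _ _ _ _ _ Ha (HM (max M M') (Nat.le_max_l _ _))).
  change (msum n (fun _ => / INR (S (max M M'))) (fun _ => 0) (S (max M M') * S (max M M')) F)
    with (u (max M M')) in H.
  apply Rabs_lt_between in H, HM'. apply Rabs_lt_between. lra.
Qed.

Definition sumsq (n : nat) (x : vec) : R := sumR n (fun i => x i ^ 2).

(** The exponential is split into two equal halves, each at most B * w1 t by exp u >= 1 + u; B = 1 +
    2 / c is chosen so that 1 + t^2 <= B (1 + c t^2 / 2). *)
Lemma gaussian_le_wt n c : 0 < c -> exists A, 0 < A /\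
  forall x, exp (- c * sumsq n x) <= A * wt n x ^ 2.
Proof.
  intros Hc. set (B := 1 + 2 / c).
  assert (HB : 1 < B) by (unfold B; assert (0 < 2 / c) by (apply Rdiv_lt_0_compat; lra); lra).
  exists ((B ^ 2) ^ n). split; [apply pow_lt, pow_lt; lra|].
  assert (one : forall t, exp (- c * t ^ 2) <= B ^ 2 * w1 t ^ 2).
  { intros t. replace (- c * t ^ 2) with (- (c * t ^ 2 / 2) + - (c * t ^ 2 / 2)) by field.
    rewrite exp_plus.
    assert (exp (- (c * t ^ 2 / 2)) <= B * w1 t).
    { rewrite exp_Ropp.
      assert (Ht : 0 <= c * t ^ 2 / 2) by (pose proof (pow2_ge_0 t); nra).
      apply Rle_trans with (/ (1 + c * t ^ 2 / 2)).
      - apply Rinv_le_contravar; [lra | apply exp_ineq1_le].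
      - unfold w1. replace (B * / (1 + t ^ 2)) with (/ ((1 + t ^ 2) / B)) by (field; nra).
        assert ((1 + t ^ 2) / B * B <= (1 + c * t ^ 2 / 2) * B).
        { replace ((1 + t ^ 2) / B * B) with (1 + t ^ 2) by (field; lra).
          unfold B. replace ((1 + c * t ^ 2 / 2) * (1 + 2 / c))
            with (1 + 2 / c + c * t ^ 2 / 2 + t ^ 2) by (field; lra).
          unfold B in HB. lra. }
        apply Rinv_le_contravar; [apply Rdiv_lt_0_compat; nra|].
        now apply Rmult_le_reg_r with B; [lra|]. }
    pose proof (exp_pos (- (c * t ^ 2 / 2))). rewrite <- Rpow_mult_distr.
    replace ((B * w1 t) ^ 2) with ((B * w1 t) * (B * w1 t)) by ring.
    apply Rmult_le_compat; lra. }
  unfold sumsq. induction n as [|n IH]; intros x.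
  - simpl. rewrite Rmult_0_r, exp_0. lra.
  - rewrite sumR_first, Rmult_plus_distr_l, exp_plus.
    change ((B ^ 2) ^ S n) with (B ^ 2 * (B ^ 2) ^ n).
    change (wt (S n) x) with (w1 (x O) * wt n (vtl x)).
    replace (B ^ 2 * (B ^ 2) ^ n * (w1 (x O) * wt n (vtl x)) ^ 2)
      with ((B ^ 2 * w1 (x O) ^ 2) * ((B ^ 2) ^ n * wt n (vtl x) ^ 2)) by ring.
    apply Rmult_le_compat; try (left; apply exp_pos); [apply one | apply (IH (vtl x))].
Qed.

Lemma Int_exists_gaussian n F C c : contn n F -> 0 < c ->
  (forall x, Rabs (F x) <= C * exp (- c * sumsq n x)) -> exists I, Int n F I.
Proof.
  intros HF Hc HC. destruct (gaussian_le_wt n c Hc) as (A & HA & HG).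
  assert (0 <= C).
  { specialize (HC (fun _ => 0)). pose proof (Rabs_pos (F (fun _ => 0))).
    pose proof (exp_pos (- c * sumsq n (fun _ => 0))). nra. }
  apply Int_exists with (A := C * A); [exact HF|]. intros x.
  eapply Rle_trans; [apply HC|]. rewrite Rmult_assoc. now apply Rmult_le_compat_l.
Qed.

(** * Sums over lists *)

(** Convertible to the [fold_right] of the statement, so that [gibbs_expect] is a quotient of two
    such sums by conversion. *)
Definition sumL {X : Type} (f : X -> R) (l : list X) : R :=
  fold_right (fun z acc => f z + acc) 0 l.

Lemma sumL_app {X} (f : X -> R) l l' : sumL f (l ++ l') = sumL f l + sumL f l'.
Proof. induction l as [|x l IH]; simpl; [lra | unfold sumL in *; rewrite IH; lra]. Qed.

Lemma sumL_flat_map {X Y} (f : Y -> R) (g : X -> list Y) l :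
  sumL f (flat_map g l) = sumL (fun x => sumL f (g x)) l.
Proof. induction l as [|x l IH]; simpl; [reflexivity | now rewrite sumL_app, IH]. Qed.

Lemma sumL_map {X Y} (f : Y -> R) (g : X -> Y) l : sumL f (map g l) = sumL (fun x => f (g x)) l.
Proof. unfold sumL. induction l as [|x l IH]; simpl; [reflexivity | now rewrite IH]. Qed.

Lemma sumL_scal {X} c (f : X -> R) l : sumL (fun x => c * f x) l = c * sumL f l.
Proof. unfold sumL. induction l as [|x l IH]; simpl; [lra | rewrite IH; lra]. Qed.

Lemma sumL_ext {X} (f g : X -> R) l : (forall x, f x = g x) -> sumL f l = sumL g l.
Proof. intros H. unfold sumL. induction l as [|x l IH]; simpl; [|rewrite IH, H]; reflexivity. Qed.

Lemma sumL_le {X} (f g : X -> R) l : (forall z, f z <= g z) -> sumL f l <= sumL g l.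
Proof.
  intros H. unfold sumL. induction l as [|z l IH]; simpl; [lra|]. specialize (H z). lra.
Qed.

Lemma sumL_plus {X} (f g : X -> R) l : sumL (fun z => f z + g z) l = sumL f l + sumL g l.
Proof. unfold sumL. induction l as [|z l IH]; simpl; [|rewrite IH]; lra. Qed.

Lemma sumL_Rabs {X} (f : X -> R) l : Rabs (sumL f l) <= sumL (fun z => Rabs (f z)) l.
Proof.
  unfold sumL. induction l as [|z l IH]; simpl; [rewrite Rabs_R0; lra|].
  eapply Rle_trans; [apply Rabs_triang | lra].
Qed.

Lemma sumL_seq f m : sumL f (seq 0 m) = sumR m f.
Proof.
  induction m as [|m IH]; [reflexivity|].
  rewrite seq_S, sumL_app, IH. simpl. lra.
Qed.

Lemma Int_lsumL {X} n (F : X -> vec -> R) (I : X -> R) l :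
  (forall z, Int n (F z) (I z)) -> Int n (fun x => sumL (fun z => F z x) l) (sumL I l).
Proof.
  intros H. induction l as [|z l IH]; simpl; [apply Int_zero | now apply Int_plus].
Qed.

Lemma grid_sum_msum n K hh F :
  hh ^ n * sumL (fun z => F (grid_point z hh)) (ivecs n K)
  = msum n (fun _ => hh) (fun _ => 0) K F.
Proof.
  revert F; induction n as [|n IH]; intros F.
  - simpl. rewrite Rmult_1_l, Rplus_0_r. f_equal. apply functional_extensionality.
    intros [|i]; unfold grid_point; simpl; ring.
  - simpl. rewrite sumL_flat_map. unfold zrange. rewrite sumL_map.
    unfold lsum. rewrite Rmult_assoc. f_equal. rewrite <- sumL_scal, sumL_seq.
    apply sumR_ext. intros j _. rewrite sumL_map.
    change (vtl (fun _ => hh)) with (fun _ : nat => hh).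
    change (vtl (fun _ => 0)) with (fun _ : nat => 0). rewrite <- IH.
    f_equal. apply sumL_ext. intros z. f_equal. apply functional_extensionality.
    intros [|i]; unfold grid_point; simpl; [|reflexivity].
    rewrite minus_IZR, <- !INR_IZR_INZ. ring.
Qed.

Lemma Int_integral_Rn n F I : Int n F I -> integral_Rn n F I.
Proof.
  intros HI eps He. destruct (HI eps He) as (d & r & Hd & Hr & H).
  (* The radius has to be positive, and [r] may be 0. *)
  exists (r + 1). split; [lra|]. intros Rb HRb. exists d. split; [exact Hd|].
  intros hh Hhh. unfold riemann_sum.
  pose proof (grid_sum_msum n (Z.to_nat (up (Rb / hh))) hh F) as E.
  unfold sumL in E. rewrite E. apply H. intros i _. rewrite Rabs_R0. split; [lra|].
  destruct (archimed (Rb / hh)) as (Hup & _).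
  assert (0 < Rb / hh) by (apply Rdiv_lt_0_compat; lra).
  assert (0 <= up (Rb / hh))%Z by (apply le_IZR; lra).
  rewrite INR_IZR_INZ, Z2Nat.id by assumption.
  apply Rle_trans with (Rb / hh * hh); [replace (Rb / hh * hh) with Rb by (field; lra); lra | apply Rmult_le_compat_r; lra].
Qed.
(** * Negative definite forms *)

(** Keeps of a homogeneous type only continuity, homogeneity and negativity, so that the Gaussian
    exponent (k = 1) and the Taylor forms at the maxima are treated alike. *)
Definition neg_form (n k : nat) (T : vec -> R) : Prop :=
  (1 <= k)%nat /\ contn n T /\
  (forall l y, 0 < l -> T (fun i => l * y i) = l ^ (2 * k) * T y) /\
  (forall y, ~ is_zero_vec n y -> T y < 0).

Lemma sumsq_nonneg n x : 0 <= sumsq n x.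
Proof. apply sumR_nonneg. intros; apply pow2_ge_0. Qed.

Lemma sumsq_coord n x i : (i < n)%nat -> x i ^ 2 <= sumsq n x.
Proof. intros Hi. apply (sumR_term_le n (fun i => x i ^ 2)); [intros; apply pow2_ge_0 | exact Hi]. Qed.

Lemma sumsq_scale n l x : sumsq n (fun i => l * x i) = l ^ 2 * sumsq n x.
Proof. unfold sumsq. rewrite <- sumR_scal. apply sumR_ext. intros; ring. Qed.

Lemma sumsq_zero n x : sumsq n x = 0 -> is_zero_vec n x.
Proof.
  intros H i Hi. pose proof (sumsq_coord n x i Hi). pose proof (pow2_ge_0 (x i)). nra.
Qed.

Lemma contn_sumsq n : contn n (sumsq n).
Proof.
  apply (contn_sum n n (fun i x => x i ^ 2)). intros i Hi. now apply contn_sqr, contn_coord.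
Qed.

Lemma normv_pow n k x : normv n x ^ (2 * k) = sumsq n x ^ k.
Proof.
  rewrite pow_mult. f_equal. unfold normv. rewrite <- Rsqr_pow2. apply Rsqr_sqrt, sumsq_nonneg.
Qed.

(** With e = d / (n + 1) the sum is at most n e^2 < (n + 1)^2 e^2; the + 1 also covers n = 0. *)
Lemma sumsq_near n d x : 0 < d -> near n (d / (INR n + 1)) x (fun _ => 0) -> sumsq n x < d ^ 2.
Proof.
  intros Hd H. pose proof (pos_INR n).
  set (e := d / (INR n + 1)) in *.
  assert (He : 0 < e) by (apply Rdiv_lt_0_compat; lra).
  assert (Hde : d = (INR n + 1) * e) by (unfold e; field; lra).
  apply Rle_lt_trans with (INR n * e ^ 2).
  - rewrite <- sumR_const. apply sumR_le. intros i Hi. specialize (H i Hi).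
    rewrite Rminus_0_r in H. rewrite <- (pow2_abs (x i)). apply pow_incr.
    pose proof (Rabs_pos (x i)). lra.
  - rewrite Hde. assert (0 < e ^ 2) by (apply pow_lt; lra). nra.
Qed.

Lemma normv_near n d x y : 0 < d -> near n (d / (INR n + 1)) x y -> normv n (vsub x y) < d.
Proof.
  intros Hd H. rewrite <- (sqrt_pow2 d) by lra. apply sqrt_lt_1; [apply sumsq_nonneg | nra |].
  apply sumsq_near; [exact Hd|]. intros i Hi. rewrite Rminus_0_r. now apply H.
Qed.

Lemma continuous_Rn_contn n phi : continuous_Rn n phi -> contn n phi.
Proof.
  intros H x eps He. destruct (H x eps He) as (d & Hd & Hc).
  pose proof (pos_INR n). exists (d / (INR n + 1)). split; [apply Rdiv_lt_0_compat; lra|].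
  intros y Hy. rewrite Rabs_minus_sym. apply Hc. apply normv_near; [exact Hd|].
  now apply near_sym.
Qed.

(** Doubling the zero vector gives T 0 = 2 ^ (2 k) T 0. *)
Lemma neg_form_zero n k T y : neg_form n k T -> is_zero_vec n y -> T y = 0.
Proof.
  intros (Hk & HT & Hh & _) Hy.
  assert (E : T (fun i => 2 * y i) = T y).
  { apply (contn_depends n T HT). intros i Hi. rewrite (Hy i Hi). ring. }
  rewrite Hh in E by lra.
  assert (1 < 2 ^ (2 * k)) by (apply Rlt_pow_R1; [lra | lia]). nra.
Qed.

Lemma neg_form_nonpos n k T y : neg_form n k T -> T y <= 0.
Proof.
  intros HT. destruct (classic (is_zero_vec n y)) as [H|H].
  - rewrite (neg_form_zero n k T y HT H). lra.
  - left. now apply HT.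
Qed.

(** Compactness bounds T away from 0 on the unit sphere, a subset of the box of radius 1, and
    homogeneity carries the bound to all vectors. *)
Lemma neg_form_coercive n k T : neg_form n k T ->
  exists c, 0 < c /\ forall y, T y <= - c * sumsq n y ^ k.
Proof.
  intros HTT. pose proof HTT as (Hk & HT & Hh & Hneg).
  destruct (box_compact_uniform n 1 (fun d x => sumsq n x = 1 -> T x <= - d)) as (c & Hc & H).
  - lra.
  - intros d d' x Hd H Hx. specialize (H Hx). lra.
  - intros t _. destruct (Req_dec (sumsq n t) 1) as [Ht|Ht].
    + assert (Tt : T t < 0).
      { apply Hneg. intros Hz. enough (sumsq n t = 0) by lra.
        unfold sumsq. rewrite (sumR_ext n _ (fun _ => 0)), sumR_const; [ring|].
        intros i Hi. rewrite (Hz i Hi). ring. }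
      destruct (HT t (- T t / 2)) as (d & Hd & Hn); [lra|].
      exists (Rmin d (- T t / 2)). split; [apply Rmin_pos; lra|]. intros x Hx _.
      pose proof (Rmin_r d (- T t / 2)).
      assert (Rabs (T x - T t) < - T t / 2)
        by (apply Hn, near_mono with (2 := Hx), Rmin_l).
      apply Rabs_lt_between in H0. lra.
    (* Near a point off the sphere the condition is vacuous, by continuity of [sumsq]. *)
    + destruct (contn_sumsq n t (Rabs (sumsq n t - 1))) as (d & Hd & Hn).
      { apply Rabs_pos_lt. lra. }
      exists d. split; [exact Hd|]. intros x Hx E. specialize (Hn x Hx).
      rewrite E, Rabs_minus_sym in Hn. lra.
  - exists c. split; [exact Hc|]. intros y.
    destruct (Req_dec (sumsq n y) 0) as [Hy|Hy].
    + rewrite Hy, pow_ne_zero by lia.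
      rewrite (neg_form_zero n k T y HTT (sumsq_zero n y Hy)). lra.
    + assert (Hp : 0 < sumsq n y) by (pose proof (sumsq_nonneg n y); lra).
      pose proof (sqrt_lt_R0 _ Hp) as Hs. set (s := sqrt (sumsq n y)) in *.
      assert (Hss : s ^ 2 = sumsq n y) by (unfold s; rewrite <- Rsqr_pow2; apply Rsqr_sqrt; lra).
      set (z := fun i => / s * y i).
      assert (Hz : sumsq n z = 1).
      { unfold z. rewrite sumsq_scale, <- Hss. field. lra. }
      assert (Tz : T z <= - c).
      { apply H; [|exact Hz]. intros i Hi. pose proof (sumsq_coord n z i Hi).
        rewrite <- pow2_abs in H0. pose proof (Rabs_pos (z i)). nra. }
      unfold z in Tz. rewrite Hh in Tz by (now apply Rinv_0_lt_compat).
      rewrite <- Hss, <- pow_mult.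
      assert (Hsk : 0 < s ^ (2 * k)) by now apply pow_lt.
      apply Rmult_le_compat_l with (r := s ^ (2 * k)) in Tz; [|lra].
      rewrite pow_inv, <- Rmult_assoc, Rinv_r, Rmult_1_l in Tz by lra. lra.
Qed.

(** By u ^ k >= u - 1 for u >= 0, a Gaussian dominates exp T whatever the degree. *)
Lemma neg_form_quadratic_bound n k T : neg_form n k T ->
  exists c, 0 < c /\ forall y, T y <= c - c * sumsq n y.
Proof.
  intros HT. destruct (neg_form_coercive n k T HT) as (c & Hc & H).
  exists c. split; [exact Hc|]. intros y. eapply Rle_trans; [apply H|].
  assert (sumsq n y - 1 <= sumsq n y ^ k); [|nra].
  pose proof (sumsq_nonneg n y) as Hp. set (u := sumsq n y) in *.
  destruct (Rle_dec u 1) as [Hu|Hu].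
  - pose proof (pow_le u k Hp). lra.
  - destruct HT as (Hk & _). pose proof (Rle_pow u 1 k (ltac:(lra)) Hk) as Hpow.
    rewrite pow_1 in Hpow. lra.
Qed.

Lemma contn_pos_near_zero n F : contn n F -> 0 < F (fun _ => 0) ->
  exists c rho, 0 < c /\ 0 < rho /\ forall x, inbox n rho x -> c <= F x.
Proof.
  intros HF H0. destruct (HF (fun _ => 0) (F (fun _ => 0) / 2)) as (d & Hd & H); [lra|].
  exists (F (fun _ => 0) / 2), (d / 2). repeat split; try lra. intros x Hx.
  assert (Hn : near n d x (fun _ => 0)).
  { intros i Hi. specialize (Hx i Hi). rewrite Rminus_0_r. lra. }
  specialize (H x Hn). apply Rabs_lt_between in H. lra.
Qed.

Lemma exp_le x y : x <= y -> exp x <= exp y.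
Proof. intros [H| ->]; [left; now apply exp_increasing | right; reflexivity]. Qed.

Lemma Int_exp_form n k T : neg_form n k T ->
  exists B, 0 < B /\ Int n (fun x => exp (T x)) B.
Proof.
  intros HT. destruct (neg_form_quadratic_bound n k T HT) as (c & Hc & H).
  assert (HC : contn n (fun x => exp (T x))) by (apply contn_exp; apply HT).
  destruct (Int_exists_gaussian n (fun x => exp (T x)) (exp c) c HC Hc) as (B & HB).
  - intros x. rewrite Rabs_pos_eq by (left; apply exp_pos). rewrite <- exp_plus.
    apply exp_le. specialize (H x). lra.
  - exists B. split; [|exact HB].
    destruct (contn_pos_near_zero n _ HC (exp_pos _)) as (e & rho & He & Hrho & Hb).
    apply (Int_pos n _ B e rho HB); trivial. intros x. left; apply exp_pos.
Qed.

Lemma Int_exp_form_scaled n k T B s m : neg_form n k T -> Int n (fun x => exp (T x)) B ->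
  0 < s -> Int n (fun x => exp (s * T (vsub x m))) (Rpower s (- (INR n / INR (2 * k))) * B).
Proof.
  intros (Hk & HT & Hh & _) HB Hs.
  assert (H2k : 0 < INR (2 * k)) by (apply lt_0_INR; lia).
  (* With l the 2k-th root of s, s T(x) = T(l x), and the Jacobian l ^ (- n) is the power of s in
     the statement. *)
  set (l := Rpower s (/ INR (2 * k))).
  assert (Hl : 0 < l) by apply exp_pos.
  assert (Hlk : l ^ (2 * k) = s).
  { rewrite <- Rpower_pow by exact Hl. unfold l. rewrite Rpower_mult, Rinv_l, Rpower_1; lra. }
  apply (Int_translate n (fun x => exp (s * T x))).
  { apply contn_depends. now apply contn_exp, contn_scal. }
  pose proof (Int_diag_scale n _ B (fun _ => l) (fun _ _ => Hl) HB) as H.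
  replace (Rpower s (- (INR n / INR (2 * k)))) with (/ prodR n (fun _ => l)).
  - apply Int_ext with (2 := H). intros x. simpl. rewrite Hh by exact Hl. now rewrite Hlk.
  - rewrite prodR_const, <- Rpower_pow by exact Hl. unfold l.
    rewrite Rpower_mult, <- Rpower_Ropp. f_equal. field. lra.
Qed.

Definition taylor (n : nat) (f : vec -> R) (t : vec) (k : nat) (T : vec -> R) : Prop :=
  forall eps, 0 < eps -> exists delta, 0 < delta /\
     forall y, 0 < normv n y < delta ->
       Rabs (f (vadd t y) - f t - T y) <= eps * normv n y ^ (2 * k).

(** Coercivity converts the remainder o(|y|^(2k)) into one relative to - T(y). The Taylor clause
    excludes y = 0, which is treated apart. *)
Lemma taylor_relative n f t k T : contn n f -> neg_form n k T -> taylor n f t k T ->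
  forall eta, 0 < eta -> exists d, 0 < d /\ forall x, near n d x t ->
    Rabs ((f x - f t) - T (vsub x t)) <= eta * - T (vsub x t).
Proof.
  intros Hf HT HTay eta Heta. destruct (neg_form_coercive n k T HT) as (c & Hc & Hco).
  destruct (HTay (eta * c)) as (d & Hd & H); [now apply Rmult_lt_0_compat|].
  pose proof (pos_INR n). exists (d / (INR n + 1)).
  split; [apply Rdiv_lt_0_compat; lra|]. intros x Hx.
  pose proof (normv_near n d x t Hd Hx) as Hnv.
  destruct (Req_dec (sumsq n (vsub x t)) 0) as [Hz|Hz].
  - pose proof (sumsq_zero n _ Hz) as Hzv.
    rewrite (neg_form_zero n k T _ HT Hzv), (contn_depends n f Hf x t).
    + rewrite Rminus_diag, Rminus_0_r, Rabs_R0. lra.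
    + intros i Hi. specialize (Hzv i Hi). unfold vsub in Hzv. lra.
  - assert (0 < normv n (vsub x t)).
    { apply sqrt_lt_R0. pose proof (sumsq_nonneg n (vsub x t)). unfold sumsq in *. lra. }
    specialize (H (vsub x t) (conj H1 Hnv)).
    replace (vadd t (vsub x t)) with x in H
      by (apply functional_extensionality; intros; unfold vadd, vsub; ring).
    eapply Rle_trans; [exact H|]. rewrite normv_pow, Rmult_assoc.
    apply Rmult_le_compat_l; [lra|]. specialize (Hco (vsub x t)). lra.
Qed.

(** * Sequences *)

(** With w the square root of N, ln N <= 2 w. For w > q the exponent is at most eta - w, because q
    eta = 2 |s| + 1; for w > e the exponential of that is below eps. *)
Lemma cv_exp_decay s eta : 0 < eta ->
  Un_cv (fun N => Rpower (INR N) s * exp (- (INR N - 1) * eta)) 0.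
Proof.
  intros Heta eps He.
  destruct (INR_unbounded (((2 * Rabs s + 1) / eta) ^ 2 + (exp eta / eps) ^ 2 + 1)) as (N0 & HN0).
  exists N0. intros N HN. apply le_INR in HN.
  set (q := (2 * Rabs s + 1) / eta) in *. set (e := exp eta / eps) in *.
  pose proof (pow2_ge_0 q). pose proof (pow2_ge_0 e).
  assert (HNp : 1 < INR N) by lra.
  set (w := sqrt (INR N)). assert (Hw : 0 < w) by (apply sqrt_lt_R0; lra).
  assert (Hww : w ^ 2 = INR N) by (unfold w; rewrite <- Rsqr_pow2; apply Rsqr_sqrt; lra).
  assert (Hq : 0 < q) by (apply Rdiv_lt_0_compat; [pose proof (Rabs_pos s)|]; lra).
  assert (He' : 0 < e) by (apply Rdiv_lt_0_compat; [apply exp_pos | exact He]).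
  assert (Hroot : forall y, 0 < y -> y ^ 2 < INR N -> y < w).
  { intros y Hy Hyn. apply Rnot_le_lt. intros C.
    assert (w ^ 2 <= y ^ 2) by (apply pow_incr; lra). lra. }
  assert (Hqw : q < w) by (apply Hroot; lra). assert (Hew : e < w) by (apply Hroot; lra).
  unfold Rdist. rewrite Rminus_0_r, Rabs_pos_eq
    by (apply Rmult_le_pos; left; apply exp_pos).
  unfold Rpower. rewrite <- exp_plus.
  assert (Hln : ln (INR N) <= 2 * w).
  { rewrite <- Hww. replace (w ^ 2) with (w * w) by ring. rewrite ln_mult by exact Hw.
    assert (ln w <= w); [|lra]. rewrite <- (ln_exp w) at 2. apply ln_le; [exact Hw|].
    pose proof (exp_ineq1_le w). lra. }
  assert (0 <= ln (INR N)) by (rewrite <- ln_1; apply ln_le; lra).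
  assert (s * ln (INR N) <= Rabs s * (2 * w)).
  { apply Rle_trans with (Rabs s * ln (INR N)).
    - apply Rmult_le_compat_r; [lra | apply Rle_abs].
    - apply Rmult_le_compat_l; [apply Rabs_pos | exact Hln]. }
  assert (Hqe : 2 * Rabs s + 1 = q * eta) by (unfold q; field; lra).
  apply Rle_lt_trans with (exp (eta + - w)).
  - apply exp_le.
    assert (q * eta * w <= eta * w ^ 2).
    { replace (q * eta * w) with (eta * w * q) by ring.
      replace (eta * w ^ 2) with (eta * w * w) by ring.
      apply Rmult_le_compat_l; [apply Rmult_le_pos|]; lra. }
    assert (Rabs s * (2 * w) = q * eta * w - w) by (rewrite <- Hqe; ring).
    rewrite Hww in *. lra.
  - rewrite exp_plus, exp_Ropp. pose proof (exp_ineq1_le w).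
    apply Rmult_lt_reg_r with (exp w); [apply exp_pos|].
    rewrite Rmult_assoc, Rinv_l, Rmult_1_r by (pose proof (exp_pos w); lra).
    replace (exp eta) with (eps * e) by (unfold e; field; lra). nra.
Qed.

Lemma cv_power_decay a : 0 < a -> Un_cv (fun N => Rpower (INR N) (- a)) 0.
Proof.
  intros Ha eps He. destruct (INR_unbounded (Rpower eps (- / a) + 1)) as (N0 & HN0).
  exists N0. intros N HN. apply le_INR in HN.
  assert (Hp : 0 < Rpower eps (- / a)) by apply exp_pos.
  unfold Rdist. rewrite Rminus_0_r, Rabs_pos_eq by (left; apply exp_pos).
  rewrite Rpower_Ropp. replace eps with (/ Rpower (Rpower eps (- / a)) a).
  - apply Rinv_lt_contravar.
    + apply Rmult_lt_0_compat; apply exp_pos.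
    + apply Rlt_Rpower_l; lra.
  - rewrite Rpower_mult, <- Rpower_Ropp. replace (- (- / a * a)) with 1 by (field; lra).
    now apply Rpower_1.
Qed.

Lemma cv_0_scal u c : Un_cv u 0 -> Un_cv (fun N => c * u N) 0.
Proof.
  intros H. rewrite <- (Rmult_0_r c). apply (CV_mult (fun _ => c) u c 0); [|exact H].
  intros eps He. exists O. intros. unfold Rdist. rewrite Rminus_diag, Rabs_R0. lra.
Qed.

Lemma cv_ext u v l : (forall N, (1 <= N)%nat -> u N = v N) -> Un_cv u l -> Un_cv v l.
Proof.
  intros H Hu eps He. destruct (Hu eps He) as (N0 & HN0). exists (S N0). intros N HN.
  rewrite <- H by lia. apply HN0. lia.
Qed.

(** * Negligible families and the Laplace method *)

(** The integrals are o(N^(- s)); s will be n / 2k*, so that this means negligible beside the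
    leading terms. *)
Definition vanishing (n : nat) (s : R) (V : nat -> vec -> R) : Prop :=
  exists v : nat -> R, (forall N, (1 <= N)%nat -> Int n (V N) (v N)) /\
    Un_cv (fun N => Rpower (INR N) s * v N) 0.

(** Smallness on a set is expressed by a majorant that is integrable and nonnegative everywhere. No
    indicator function is ever integrated, and a union of sets costs a sum of majorants. *)
Definition small_on (n : nat) (s : R) (S : vec -> Prop) (F : nat -> vec -> R) : Prop :=
  exists V, vanishing n s V /\
    forall N x, (1 <= N)%nat -> 0 <= V N x /\ (S x -> Rabs (F N x) <= V N x).

Lemma vanishing_plus n s V W : vanishing n s V -> vanishing n s W ->
  vanishing n s (fun N x => V N x + W N x).
Proof.
  intros (v & Hv & Cv) (w & Hw & Cw). exists (fun N => v N + w N). split.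
  - intros N HN. now apply Int_plus; [apply Hv | apply Hw].
  - rewrite <- (Rplus_0_r 0). apply cv_ext with (2 := CV_plus _ _ _ _ Cv Cw).
    intros N _. ring.
Qed.

Lemma vanishing_scal n s c V : vanishing n s V -> vanishing n s (fun N x => c * V N x).
Proof.
  intros (v & Hv & Cv). exists (fun N => c * v N). split.
  - intros N HN. now apply Int_scal, Hv.
  - apply cv_ext with (2 := cv_0_scal _ c Cv). intros N _. ring.
Qed.

Lemma small_plus n s S F G : small_on n s S F -> small_on n s S G ->
  small_on n s S (fun N x => F N x + G N x).
Proof.
  intros (V & HV & H) (W & HW & H'). exists (fun N x => V N x + W N x).
  split; [now apply vanishing_plus|]. intros N x HN.
  destruct (H N x HN) as (V0 & HV'). destruct (H' N x HN) as (W0 & HW').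
  split; [lra|]. intros Hx. specialize (HV' Hx). specialize (HW' Hx).
  eapply Rle_trans; [apply Rabs_triang | lra].
Qed.

Lemma small_mult n s S b (g : vec -> R) F : (forall x, Rabs (g x) <= b) -> small_on n s S F ->
  small_on n s S (fun N x => g x * F N x).
Proof.
  intros Hg (V & HV & H). exists (fun N x => b * V N x).
  split; [now apply vanishing_scal|]. intros N x HN. destruct (H N x HN) as (V0 & HV').
  assert (0 <= b) by (eapply Rle_trans; [apply Rabs_pos | apply (Hg x)]).
  split; [now apply Rmult_le_pos|]. intros Hx. rewrite Rabs_mult.
  apply Rmult_le_compat; try apply Rabs_pos; auto.
Qed.

Lemma small_zero n s S : small_on n s S (fun _ _ => 0).
Proof.
  exists (fun _ _ => 0). split.
  - exists (fun _ => 0). split; [intros; apply Int_zero|].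
    intros eps He. exists O. intros. unfold Rdist. rewrite Rmult_0_r, Rminus_diag, Rabs_R0. lra.
  - intros N x _. rewrite Rabs_R0. lra.
Qed.

Lemma small_mono n s (S S' : vec -> Prop) F : (forall x, S x -> S' x) ->
  small_on n s S' F -> small_on n s S F.
Proof.
  intros HS (V & HV & H). exists V. split; [exact HV|]. intros N x HN.
  destruct (H N x HN). split; auto.
Qed.

(** Abstracts a family of neighbourhoods, of a point or of infinity, that decreases as d tends to 0;
    [ev_small] is then smallness on some neighbourhood. *)
Definition shrinking (S : R -> vec -> Prop) : Prop :=
  forall d d' x, d <= d' -> S d x -> S d' x.

Definition ev_small n s (S : R -> vec -> Prop) F : Prop :=
  exists d, 0 < d /\ small_on n s (S d) F.

Lemma ev_small_plus n s S F G : shrinking S -> ev_small n s S F -> ev_small n s S G ->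
  ev_small n s S (fun N x => F N x + G N x).
Proof.
  intros HS (d & Hd & H) (d' & Hd' & H'). exists (Rmin d d'). split; [now apply Rmin_pos|].
  apply small_plus.
  - apply small_mono with (2 := H). intros x. apply HS, Rmin_l.
  - apply small_mono with (2 := H'). intros x. apply HS, Rmin_r.
Qed.

Lemma ev_small_mult n s S b g F : (forall x, Rabs (g x) <= b) -> ev_small n s S F ->
  ev_small n s S (fun N x => g x * F N x).
Proof. intros Hg (d & Hd & H). exists d. split; [exact Hd|]. now apply small_mult with b. Qed.

Lemma ev_small_sum n s S m (F : nat -> nat -> vec -> R) : shrinking S ->
  (forall q, (q < m)%nat -> ev_small n s S (F q)) ->
  ev_small n s S (fun N x => sumR m (fun q => F q N x)).
Proof.
  intros HS. induction m as [|m IH]; intros H; simpl.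
  - exists 1. split; [lra | apply small_zero].
  - apply ev_small_plus; [exact HS | apply IH; intros; apply H | apply H]; lia.
Qed.

(* One factor [exp g] is kept for integrability, the other [N - 1] supply the decay. *)
Lemma small_exp n s (S : vec -> Prop) g I eta : Int n (fun x => exp (g x)) I -> 0 < eta ->
  (forall x, S x -> g x <= - eta) -> small_on n s S (fun N x => exp (INR N * g x)).
Proof.
  intros HI Heta Hg. exists (fun N x => exp (- (INR N - 1) * eta) * exp (g x)). split.
  - exists (fun N => exp (- (INR N - 1) * eta) * I). split.
    + intros N _. now apply Int_scal.
    + apply cv_ext with (2 := cv_0_scal _ I (cv_exp_decay s eta Heta)). intros; ring.
  - intros N x HN. apply le_INR in HN. simpl in HN.
    split; [apply Rmult_le_pos; left; apply exp_pos|]. intros Hx.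
    rewrite Rabs_pos_eq by (left; apply exp_pos). rewrite <- exp_plus.
    apply exp_le. specialize (Hg x Hx). nra.
Qed.

(** The radius is / d so that, like balls, these sets shrink with d; monotonicity needs d > 0, hence
    the conjunct 0 < d wherever the family is used. *)
Definition near_infinity (n : nat) (d : R) (x : vec) : Prop := ~ inbox n (/ d) x.

Lemma near_infinity_shrinking n : shrinking (fun d x => 0 < d /\ near_infinity n d x).
Proof.
  intros d d' x Hd (Hd0 & H). split; [lra|]. intros C. apply H. intros i Hi.
  eapply Rle_trans; [apply (C i Hi)|]. apply Rinv_le_contravar; lra.
Qed.

Lemma near_shrinking n t : shrinking (fun d x => near n d x t).
Proof. intros d d' x Hd. now apply near_mono. Qed.

Lemma sumsq_far n b r x : 0 <= r -> ~ inbox n (r + b) x ->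
  forall m, (forall i, (i < n)%nat -> Rabs (m i) <= b) -> r ^ 2 <= sumsq n (vsub x m).
Proof.
  intros Hr Hx m Hm. apply not_all_ex_not in Hx as (i & Hx).
  apply imply_to_and in Hx as (Hi & Hx). apply Rnot_le_lt in Hx. specialize (Hm i Hi).
  eapply Rle_trans; [|apply (sumsq_coord n (vsub x m) i Hi)]. unfold vsub.
  rewrite <- (pow2_abs (x i - m i)). apply pow_incr. split; [exact Hr|].
  pose proof (Rabs_triang_inv (x i) (m i)). lra.
Qed.

Lemma ev_small_infinity n s g I c c' m : Int n (fun x => exp (g x)) I -> 0 < c ->
  (forall x, g x <= c' - c * sumsq n (vsub x m)) ->
  ev_small n s (fun d x => 0 < d /\ near_infinity n d x) (fun N x => exp (INR N * g x)).
Proof.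
  intros HI Hc Hg. destruct (finite_upper_bound n (fun i => Rabs (m i))) as (b & Hb & Hm).
  (* As r >= 1, c r^2 >= c r = |c'| + 1 + c, so g <= - 1 at distance r from [m]. *)
  set (r := (Rabs c' + 1) / c + 1).
  assert (Hr0 : 0 < (Rabs c' + 1) / c)
    by (apply Rdiv_lt_0_compat; [pose proof (Rabs_pos c')|]; lra).
  assert (Hr : 0 < r + b) by (unfold r; lra).
  exists (/ (r + b)). split; [now apply Rinv_0_lt_compat|].
  apply small_exp with (I := I) (eta := 1); [exact HI | lra |].
  intros x (_ & Hx). unfold near_infinity in Hx. rewrite Rinv_inv in Hx.
  assert (r ^ 2 <= sumsq n (vsub x m)) by (apply sumsq_far with b; trivial; unfold r; lra).
  specialize (Hg x). pose proof (Rle_abs c').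
  assert (Hcr : c * r = Rabs c' + 1 + c) by (unfold r; field; lra).
  assert (Hr1 : 1 <= r) by (unfold r; lra).
  assert (c * r <= c * r ^ 2) by (apply Rmult_le_compat_l; [lra | clear - Hr1; nra]).
  assert (c * r ^ 2 <= c * sumsq n (vsub x m)) by (apply Rmult_le_compat_l; lra). lra.
Qed.

Lemma ev_small_near_neg n s g I t : Int n (fun x => exp (g x)) I -> contn n g -> g t < 0 ->
  ev_small n s (fun d x => near n d x t) (fun N x => exp (INR N * g x)).
Proof.
  intros HI Hg Ht. destruct (Hg t (- g t / 2)) as (d & Hd & H); [lra|].
  exists d. split; [exact Hd|]. apply small_exp with (I := I) (eta := - g t / 2); [exact HI | lra |].
  intros x Hx. specialize (H x Hx). apply Rabs_lt_between in H. lra.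
Qed.

(** Put u = - N b. Both exponents are at most - 3u/4, so the difference is at most eta u exp(-
    3u/4), and u exp(- u/4) <= 4. Keeping exp(- u/2) leaves an error with an integral of the same
    order in N as the main term. *)
Lemma exp_comparison N a b eta : 0 <= N -> b <= 0 -> 0 <= eta <= / 4 ->
  Rabs (a - b) <= eta * - b ->
  exp (N * a) <= exp (N / 2 * b) /\ Rabs (exp (N * a) - exp (N * b)) <= 4 * eta * exp (N / 2 * b).
Proof.
  intros HN Hb Heta Hab. apply Rabs_le_between in Hab.
  assert (Hnb : 0 <= N * - b) by (apply Rmult_le_pos; lra).
  set (u := N * - b) in *.
  assert (H1 : N * a <= - u + eta * u) by (unfold u; nra).
  assert (H2 : - u - eta * u <= N * a) by (unfold u; nra).
  assert (Eb : N * b = - u) by (unfold u; ring).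
  assert (Eh : N / 2 * b = - u / 2) by (unfold u; field).
  rewrite Eb, Eh. assert (eta * u <= u / 4) by nra.
  split; [apply exp_le; lra|].
  assert (Hx : forall x y, x - y <= eta * u -> x <= - (3 / 4) * u ->
    exp x - exp y <= 4 * eta * exp (- u / 2)).
  { intros x y Hxy Hxu.
    assert (exp x - exp y <= (x - y) * exp x).
    { replace y with (y - x + x) at 1 by ring. rewrite exp_plus.
      pose proof (exp_ineq1_le (y - x)). pose proof (exp_pos x). nra. }
    pose proof (exp_pos x). pose proof (exp_pos (- u / 2)).
    assert (Hu4 : u * exp (- u / 4) <= 4).
    { replace (- u / 4) with (- (u / 4)) by field. rewrite exp_Ropp.
      pose proof (exp_ineq1_le (u / 4)). pose proof (exp_pos (u / 4)).
      apply Rmult_le_reg_r with (exp (u / 4)); [apply exp_pos|].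
      rewrite Rmult_assoc, Rinv_l by lra. lra. }
    assert (Hex : exp x <= exp (- u / 4) * exp (- u / 2)).
    { rewrite <- exp_plus. apply exp_le. lra. }
    apply Rle_trans with (eta * u * (exp (- u / 4) * exp (- u / 2))).
    - apply Rle_trans with (eta * u * exp x); [nra|].
      apply Rmult_le_compat_l; [apply Rmult_le_pos; lra | exact Hex].
    - replace (eta * u * (exp (- u / 4) * exp (- u / 2)))
        with (eta * (u * exp (- u / 4)) * exp (- u / 2)) by ring.
      apply Rmult_le_compat_r; [lra|]. rewrite (Rmult_comm 4). apply Rmult_le_compat_l; lra. }
  apply Rabs_le. split.
  - enough (exp (- u) - exp (N * a) <= 4 * eta * exp (- u / 2)) by lra. apply Hx; lra.
  - apply Hx; lra.
Qed.

(* A maximum of strictly lower type contributes N^(-n/2k) with a larger exponent. *)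
Lemma ev_small_lower_type n f t k T K : (1 <= n)%nat -> contn n f -> neg_form n k T ->
  taylor n f t k T -> (k < K)%nat ->
  ev_small n (INR n / INR (2 * K)) (fun d x => near n d x t)
    (fun N x => exp (INR N * (f x - f t))).
Proof.
  intros Hn Hf HT HTay HkK.
  destruct (taylor_relative n f t k T Hf HT HTay (/ 4)) as (d & Hd & H); [lra|].
  destruct (Int_exp_form n k T HT) as (B & HB & HI).
  exists d. split; [exact Hd|].
  exists (fun N x => exp (INR N / 2 * T (vsub x t))). split.
  - exists (fun N => Rpower (INR N / 2) (- (INR n / INR (2 * k))) * B). split.
    + intros N HN. apply Int_exp_form_scaled; trivial.
      apply Rdiv_lt_0_compat; [apply lt_0_INR; lia | lra].
    + assert (Hk1 : 0 < INR (2 * k)) by (apply lt_0_INR; destruct HT; lia).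
      assert (HK1 : INR (2 * k) < INR (2 * K)) by (apply lt_INR; lia).
      assert (Hn0 : 0 < INR n) by (apply lt_0_INR; lia).
      set (a := INR n / INR (2 * k) - INR n / INR (2 * K)).
      assert (Ha : 0 < a).
      { unfold a, Rdiv. rewrite <- Rmult_minus_distr_l. apply Rmult_lt_0_compat; [exact Hn0|].
        apply Rlt_0_minus, Rinv_lt_contravar; [apply Rmult_lt_0_compat|]; lra. }
      apply cv_ext with (2 := cv_0_scal _ (Rpower (/ 2) (- (INR n / INR (2 * k))) * B)
        (cv_power_decay a Ha)).
      intros N HN. assert (0 < INR N) by (apply lt_0_INR; lia).
      change (INR N / 2) with (INR N * / 2). rewrite <- Rpower_mult_distr by lra.
      replace (- a) with (INR n / INR (2 * K) + - (INR n / INR (2 * k))) by (unfold a; ring).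
      rewrite Rpower_plus. ring.
  - intros N x _. split; [left; apply exp_pos|]. intros Hx.
    rewrite Rabs_pos_eq by (left; apply exp_pos).
    apply (exp_comparison (INR N) _ _ (/ 4)); [apply pos_INR | | lra | now apply H].
    now apply neg_form_nonpos with (1 := HT).
Qed.
(* Near the maximum [mu p] the density is compared with [exp (N T_p)], with an error
   absorbed by [exp (N T_p / 2)]; everything else is negligible. *)
Lemma laplace_pointwise n f M K P (mu : nat -> vec) (T : nat -> vec -> R) (B : nat -> R)
  c c' phi b eps :
  (1 <= n)%nat -> contn n f -> 0 < c -> (forall x, f x - M <= c' - c * sumsq n x) ->
  (forall p, (p < P)%nat -> f (mu p) = M /\ neg_form n K (T p) /\ taylor n f (mu p) K (T p) /\
    Int n (fun x => exp (T p x)) (B p)) ->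
  (forall p q, (p < P)%nat -> (q < P)%nat -> p <> q -> ~ eqv n (mu p) (mu q)) ->
  (forall t, (forall p, (p < P)%nat -> ~ eqv n t (mu p)) -> f t < M \/
    (f t = M /\ exists k T', (k < K)%nat /\ neg_form n k T' /\ taylor n f t k T')) ->
  contn n phi -> (forall x, Rabs (phi x) <= b) -> 0 < eps ->
  exists V, vanishing n (INR n / INR (2 * K)) V /\ forall N x, (1 <= N)%nat ->
    Rabs (phi x * exp (INR N * (f x - M))
          - sumR P (fun p => phi (mu p) * exp (INR N * T p (vsub x (mu p)))))
    <= eps * sumR P (fun p => exp (INR N / 2 * T p (vsub x (mu p)))) + V N x.
Proof.
  intros Hn Hf Hc Hdec HT Hdist Hother Hphi Hb Heps.
  set (s := INR n / INR (2 * K)).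
  set (D := fun N x => phi x * exp (INR N * (f x - M))
          - sumR P (fun p => phi (mu p) * exp (INR N * T p (vsub x (mu p))))).
  set (U := fun N x => sumR P (fun p => exp (INR N / 2 * T p (vsub x (mu p))))).
  assert (HU : forall N x, 0 <= eps * U N x).
  { intros N x. apply Rmult_le_pos; [lra|]. apply sumR_nonneg. intros; left; apply exp_pos. }
  (* The property fed to [box_compact]. Over a union the majorants V add up, but the term eps * U
     does not, since each point needs it only once; hence it is kept out of V. *)
  set (Good := fun S : vec -> Prop => exists V, vanishing n s V /\ forall N x, (1 <= N)%nat ->
     0 <= V N x /\ (S x -> Rabs (D N x) <= eps * U N x + V N x)).
  assert (Gsmall : forall S, small_on n s S D -> Good S).
  { intros S (V & HV & H). exists V. split; [exact HV|]. intros N x HN.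
    destruct (H N x HN) as (H0 & H1). split; [exact H0|]. intros Hx.
    specialize (H1 Hx). specialize (HU N x). lra. }
  assert (Gcup : forall S S' : vec -> Prop, Good S -> Good S' -> Good (fun x => S x \/ S' x)).
  { intros S S' (V & HV & H) (W & HW & H'). exists (fun N x => V N x + W N x).
    split; [now apply vanishing_plus|]. intros N x HN.
    destruct (H N x HN) as (V0 & H1). destruct (H' N x HN) as (W0 & H2).
    split; [lra|]. intros [Hx|Hx]; [specialize (H1 Hx) | specialize (H2 Hx)]; lra. }
  assert (Gsub : forall S S' : vec -> Prop, (forall x, S x -> S' x) -> Good S' -> Good S).
  { intros S S' HS (V & HV & H). exists V. split; [exact HV|]. intros N x HN.
    destruct (H N x HN). split; auto. }
  assert (HIE : exists I, Int n (fun x => exp (f x - M)) I).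
  { apply Int_exists_gaussian with (C := exp c') (c := c); [|exact Hc|].
    - apply contn_exp. apply contn_plus; [exact Hf | apply contn_const].
    - intros x. rewrite Rabs_pos_eq by (left; apply exp_pos). rewrite <- exp_plus.
      apply exp_le. specialize (Hdec x). lra. }
  destruct HIE as (I & HI).
  assert (HIT : forall p, (p < P)%nat -> exists B', Int n (fun x => exp (T p (vsub x (mu p)))) B').
  { intros p Hp. destruct (HT p Hp) as (_ & HTp & _ & HB). exists (B p).
    apply (Int_translate n (fun x => exp (T p x))); [|exact HB].
    apply contn_depends, contn_exp, HTp. }
  assert (Dsplit : forall S, shrinking S -> ev_small n s S (fun N x => exp (INR N * (f x - M))) ->
    (forall q, (q < P)%nat -> ev_small n s S (fun N x => exp (INR N * T q (vsub x (mu q))))) ->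
    ev_small n s S D).
  { intros S HS H1 H2. unfold D.
    destruct (ev_small_plus n s S _ _ HS (ev_small_mult n s S b phi _ Hb H1)
      (ev_small_mult n s S 1 (fun _ => -1) _ (ltac:(intros; rewrite Rabs_left; lra))
        (ev_small_sum n s S P (fun q N x => phi (mu q) * exp (INR N * T q (vsub x (mu q)))) HS
          (fun q Hq => ev_small_mult n s S b (fun _ => phi (mu q)) _ (fun _ => Hb _) (H2 q Hq)))))
      as (d & Hd & V & HV & H).
    exists d. split; [exact Hd|]. exists V. split; [exact HV|]. intros N x HN.
    destruct (H N x HN) as (V0 & HS'). split; [exact V0|]. intros Hx.
    eapply Rle_trans; [|apply (HS' Hx)]. right. f_equal. ring. }
  assert (Tneg : forall q t, (q < P)%nat -> ~ eqv n t (mu q) ->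
    ev_small n s (fun d x => near n d x t) (fun N x => exp (INR N * T q (vsub x (mu q))))).
  { intros q t Hq Hne. destruct (HIT q Hq) as (B' & HB'). destruct (HT q Hq) as (_ & HTq & _).
    apply (ev_small_near_neg n s _ B' t HB').
    - apply contn_shift, HTq.
    - apply HTq. intros C. apply Hne. intros i Hi. specialize (C i Hi). unfold vsub in C. lra. }
  assert (Ginf : exists r, 0 <= r /\ Good (fun x => ~ inbox n r x)).
  { destruct (Dsplit (fun d x => 0 < d /\ near_infinity n d x)) as (d & Hd & H).
    - apply near_infinity_shrinking.
    - apply ev_small_infinity with (I := I) (c := c) (c' := c') (m := fun _ => 0); trivial.
      intros x. specialize (Hdec x). replace (sumsq n (vsub x (fun _ => 0))) with (sumsq n x); [exact Hdec|].
      unfold sumsq, vsub. apply sumR_ext. intros; ring.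
    - intros q Hq. destruct (HIT q Hq) as (B' & HB'). destruct (HT q Hq) as (_ & HTq & _).
      destruct (neg_form_quadratic_bound n K (T q) HTq) as (e & He & Hq').
      apply ev_small_infinity with (I := B') (c := e) (c' := e) (m := mu q); trivial.
    - exists (/ d). split; [left; now apply Rinv_0_lt_compat|]. apply Gsmall.
      apply small_mono with (2 := H). intros x Hx. now split. }
  destruct Ginf as (r & Hr & Ginf).
  assert (Gbox : Good (inbox n r)).
  { apply box_compact; [exact Hr | exact Gsub | exact Gcup |]. intros t _.
    destruct (classic (exists p, (p < P)%nat /\ eqv n t (mu p))) as [(p & Hp & Htp)|Hno].
    - destruct (HT p Hp) as (Hfp & HTp & Htay & _).
      assert (Hnear : forall d x, near n d x t -> near n d x (mu p)).
      { intros d x Hx i Hi. rewrite <- (Htp i Hi). now apply Hx. }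
      (* Near mu p the terms of all other maxima are negligible; the coefficient 0 at q = p reserves
         the p-th term for direct comparison. *)
      destruct (ev_small_sum n s (fun d x => near n d x t) P
        (fun q N x => (if Nat.eqb p q then 0 else - phi (mu q)) * exp (INR N * T q (vsub x (mu q)))))
        as (d1 & Hd1 & V & HV & HVb).
      { apply near_shrinking. }
      { intros q Hq.
        destruct (Nat.eqb_spec p q) as [->|Hpq].
        - exists 1. split; [lra|]. destruct (small_zero n s (fun x => near n 1 x t)) as (V & HV & H).
          exists V. split; [exact HV|]. intros N x HN. rewrite Rmult_0_l. now apply H.
        - apply (ev_small_mult n s _ b (fun _ => - phi (mu q))).
          + intros _. rewrite Rabs_Ropp. apply Hb.
          + apply Tneg; [exact Hq|]. intros C. apply (Hdist p q Hp Hq Hpq).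
            intros i Hi. now rewrite <- (Htp i Hi), (C i Hi). }
      assert (Hb0 : 0 <= b) by (eapply Rle_trans; [apply Rabs_pos | apply (Hb (mu p))]).
      (* The bound / 4 is the range of [exp_comparison]; the other one gives b * (4 eta) <= eps / 2,
         with b + 1 in case b = 0. The oscillation of phi takes the remaining eps / 2. *)
      set (eta := Rmin (/ 4) (eps / (8 * (b + 1)))).
      assert (Heta : 0 < eta) by (apply Rmin_pos; [lra | apply Rdiv_lt_0_compat; lra]).
      assert (Heta4 : eta <= / 4) by apply Rmin_l.
      assert (Hetab : b * (4 * eta) <= eps / 2).
      { apply Rle_trans with (b * (4 * (eps / (8 * (b + 1))))).
        - apply Rmult_le_compat_l; [exact Hb0|]. apply Rmult_le_compat_l; [lra | apply Rmin_r].
        - apply Rle_trans with ((b + 1) * (4 * (eps / (8 * (b + 1))))).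
          + apply Rmult_le_compat_r; [|lra].
            assert (0 < eps / (8 * (b + 1))) by (apply Rdiv_lt_0_compat; lra). lra.
          + right. field. lra. }
      destruct (taylor_relative n f (mu p) K (T p) Hf HTp Htay eta Heta) as (d2 & Hd2 & H2).
      destruct (Hphi (mu p) (eps / 2)) as (d3 & Hd3 & H3); [lra|].
      exists (Rmin d1 (Rmin d2 d3)). split; [repeat apply Rmin_pos; assumption|].
      exists V. split; [exact HV|]. intros N x HN. destruct (HVb N x HN) as (V0 & HVx).
      split; [exact V0|]. intros Hx.
      specialize (HVx (near_mono _ _ _ _ _ (Rmin_l _ _) Hx)).
      pose proof (near_mono _ _ _ _ _ (Rmin_r _ _) Hx) as Hx'.
      specialize (H2 x (Hnear _ _ (near_mono _ _ _ _ _ (Rmin_l _ _) Hx'))).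
      specialize (H3 x (Hnear _ _ (near_mono _ _ _ _ _ (Rmin_r _ _) Hx'))).
      rewrite Hfp in H2.
      destruct (exp_comparison (INR N) (f x - M) (T p (vsub x (mu p))) eta) as (E1 & E2);
        [apply pos_INR | now apply neg_form_nonpos with (1 := HTp) | lra | exact H2 |].
      set (ep := exp (INR N / 2 * T p (vsub x (mu p)))) in *.
      set (eN := exp (INR N * (f x - M))) in *.
      set (eT := exp (INR N * T p (vsub x (mu p)))) in *.
      assert (HepU : ep <= U N x).
      { apply (sumR_term_le P (fun p => exp (INR N / 2 * T p (vsub x (mu p)))) p);
          [intros; left; apply exp_pos | exact Hp]. }
      assert (HD : D N x = (phi x - phi (mu p)) * eN + phi (mu p) * (eN - eT)
        + sumR P (fun q => (if Nat.eqb p q then 0 else - phi (mu q)) * exp (INR N * T q (vsub x (mu q))))).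
      { unfold D. fold eN.
        rewrite (sumR_ext P (fun q => (if Nat.eqb p q then 0 else - phi (mu q)) * exp (INR N * T q (vsub x (mu q))))
          (fun q => (if Nat.eqb p q then 1 else 0) * (phi (mu q) * exp (INR N * T q (vsub x (mu q))))
             - phi (mu q) * exp (INR N * T q (vsub x (mu q)))))
          by (intros q _; destruct (Nat.eqb p q); ring).
        rewrite sumR_minus, sumR_delta by exact Hp. fold eT. ring. }
      rewrite HD. eapply Rle_trans; [apply Rabs_triang|].
      apply Rplus_le_compat; [|exact HVx].
      eapply Rle_trans; [apply Rabs_triang|]. rewrite !Rabs_mult.
      assert (0 < eN) by apply exp_pos. assert (0 < ep) by apply exp_pos.
      assert (Rabs (phi x - phi (mu p)) * Rabs eN <= eps / 2 * ep).
      { rewrite (Rabs_pos_eq eN) by lra. apply Rmult_le_compat; try lra. apply Rabs_pos. }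
      assert (Rabs (phi (mu p)) * Rabs (eN - eT) <= b * (4 * eta * ep)).
      { apply Rmult_le_compat; try apply Rabs_pos; [apply Hb | exact E2]. }
      assert (b * (4 * eta * ep) <= eps / 2 * ep).
      { rewrite <- Rmult_assoc. apply Rmult_le_compat_r; lra. }
      apply Rle_trans with (eps * ep); [lra|]. apply Rmult_le_compat_l; lra.
    - assert (Hno' : forall p, (p < P)%nat -> ~ eqv n t (mu p)) by (intros p Hp C; apply Hno; eauto).
      destruct (Dsplit (fun d x => near n d x t)) as (d & Hd & H).
      + apply near_shrinking.
      + destruct (Hother t Hno') as [Hlt|(Heq & k & T' & Hk & HT' & Htay)].
        * apply ev_small_near_neg with (I := I); [exact HI | | lra].
          apply contn_plus; [exact Hf | apply contn_const].
        * rewrite <- Heq. unfold s. now apply ev_small_lower_type with (k := k) (T := T').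
      + intros q Hq. now apply Tneg, Hno'.
      + exists d. split; [exact Hd|]. now apply Gsmall. }
  destruct (Gsub (fun _ => True) _ (fun x _ => classic (inbox n r x)) (Gcup _ _ Gbox Ginf))
    as (V & HV & H).
  exists V. split; [exact HV|]. intros N x HN. now apply (H N x HN).
Qed.

Lemma laplace_limit n f M K P (mu : nat -> vec) (T : nat -> vec -> R) (B : nat -> R)
  c c' phi b :
  (1 <= n)%nat -> contn n f -> 0 < c -> (forall x, f x - M <= c' - c * sumsq n x) ->
  (forall p, (p < P)%nat -> f (mu p) = M /\ neg_form n K (T p) /\ taylor n f (mu p) K (T p) /\
    0 < B p /\ Int n (fun x => exp (T p x)) (B p)) ->
  (forall p q, (p < P)%nat -> (q < P)%nat -> p <> q -> ~ eqv n (mu p) (mu q)) ->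
  (forall t, (forall p, (p < P)%nat -> ~ eqv n t (mu p)) -> f t < M \/
    (f t = M /\ exists k T', (k < K)%nat /\ neg_form n k T' /\ taylor n f t k T')) ->
  contn n phi -> (forall x, Rabs (phi x) <= b) ->
  forall eps, 0 < eps -> exists N0 : nat, forall N I, (N0 <= N)%nat -> (1 <= N)%nat ->
    Int n (fun x => phi x * exp (INR N * (f x - M))) I ->
    Rabs (Rpower (INR N) (INR n / INR (2 * K)) * I - sumR P (fun p => B p * phi (mu p))) < eps.
Proof.
  intros Hn Hf Hc Hdec HT Hdist Hother Hphi Hb eps Heps.
  set (s := INR n / INR (2 * K)).
  (* N^s times the integral of the half-exponent terms, hence the power of / 2. It does not depend
     on N, so the tolerance [e] can be fixed before N. *)
  set (Btot := sumR P (fun p => Rpower (/ 2) (- s) * B p)).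
  assert (HBt : 0 <= Btot).
  { apply sumR_nonneg. intros p Hp. apply Rmult_le_pos; left; [apply exp_pos | now apply HT]. }
  set (e := eps / (2 * (Btot + 1))).
  assert (He : 0 < e) by (apply Rdiv_lt_0_compat; lra).
  assert (HeB : e * Btot <= eps / 2).
  { apply Rle_trans with (e * (Btot + 1)); [apply Rmult_le_compat_l; lra|].
    right. unfold e. field. lra. }
  destruct (laplace_pointwise n f M K P mu T B c c' phi b e Hn Hf Hc Hdec) as (V & (v & Hv & Cv) & H);
    trivial.
  { intros p Hp. destruct (HT p Hp) as (H1 & H2 & H3 & _ & H4). auto. }
  fold s in Cv. destruct (Cv (eps / 2)) as (N0 & HN0); [lra|].
  exists N0. intros N I HN HN1 HI. specialize (HN0 N HN). unfold Rdist in HN0.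
  assert (HNp : 0 < INR N) by (apply lt_0_INR; lia).
  assert (IT : forall a p, 0 < a -> (p < P)%nat ->
     Int n (fun x => exp (a * T p (vsub x (mu p)))) (Rpower a (- s) * B p)).
  { intros a p Ha Hp. destruct (HT p Hp) as (_ & H2 & _ & _ & H4).
    now apply Int_exp_form_scaled. }
  assert (ID : Int n (fun x => phi x * exp (INR N * (f x - M)) + -1 *
      sumR P (fun p => phi (mu p) * exp (INR N * T p (vsub x (mu p)))))
    (I + -1 * sumR P (fun p => phi (mu p) * (Rpower (INR N) (- s) * B p)))).
  { apply Int_plus; [exact HI|]. apply Int_scal.
    apply (Int_sum n P (fun p x => phi (mu p) * exp (INR N * T p (vsub x (mu p))))).
    intros p Hp. now apply Int_scal, IT. }
  assert (IU : Int n (fun x => e * sumR P (fun p => exp (INR N / 2 * T p (vsub x (mu p)))) + V N x)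
    (e * sumR P (fun p => Rpower (INR N / 2) (- s) * B p) + v N)).
  { apply Int_plus; [apply Int_scal | now apply Hv].
    apply (Int_sum n P (fun p x => exp (INR N / 2 * T p (vsub x (mu p))))).
    intros p Hp. apply IT; [lra | exact Hp]. }
  assert (Habs := Int_Rabs_le n _ _ _ _ ID IU).
  assert (HNs : 0 < Rpower (INR N) s) by apply exp_pos.
  assert (Hinv : Rpower (INR N) s * Rpower (INR N) (- s) = 1).
  { rewrite <- Rpower_plus, Rplus_opp_r. now apply Rpower_O. }
  assert (E1 : Rpower (INR N) s * I - sumR P (fun p => B p * phi (mu p)) =
     Rpower (INR N) s * (I + -1 * sumR P (fun p => phi (mu p) * (Rpower (INR N) (- s) * B p)))).
  { rewrite Rmult_plus_distr_l. unfold Rminus. f_equal.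
    replace (sumR P (fun p => phi (mu p) * (Rpower (INR N) (- s) * B p)))
      with (Rpower (INR N) (- s) * sumR P (fun p => B p * phi (mu p)))
      by (rewrite <- sumR_scal; apply sumR_ext; intros; ring).
    transitivity (- (Rpower (INR N) s * Rpower (INR N) (- s)) * sumR P (fun p => B p * phi (mu p)));
      [rewrite Hinv|]; ring. }
  assert (E2 : Rpower (INR N) s * (e * sumR P (fun p => Rpower (INR N / 2) (- s) * B p) + v N)
    = e * Btot + Rpower (INR N) s * v N).
  { replace (sumR P (fun p => Rpower (INR N / 2) (- s) * B p)) with (Rpower (INR N) (- s) * Btot).
    - transitivity (e * ((Rpower (INR N) s * Rpower (INR N) (- s)) * Btot) + Rpower (INR N) s * v N);
        [|rewrite Hinv]; ring.
    - unfold Btot. rewrite <- sumR_scal. apply sumR_ext. intros p _.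
      change (INR N / 2) with (INR N * / 2). rewrite <- Rpower_mult_distr by lra. ring. }
  rewrite E1, Rabs_mult, (Rabs_pos_eq (Rpower (INR N) s)) by lra.
  apply Rle_lt_trans with (e * Btot + Rpower (INR N) s * v N).
  - rewrite <- E2. apply Rmult_le_compat_l; [lra|]. apply Habs. intros x.
    specialize (H N x HN1). replace (-1 * sumR P (fun p => phi (mu p) * exp (INR N * T p (vsub x (mu p)))))
      with (- sumR P (fun p => phi (mu p) * exp (INR N * T p (vsub x (mu p))))) by ring. exact H.
  - rewrite Rminus_0_r in HN0. pose proof (Rle_abs (Rpower (INR N) s * v N)). lra.
Qed.
(** * The Gaussian linearization *)

Lemma cosh_pos x : 0 < cosh x.
Proof. unfold cosh. pose proof (exp_pos x). pose proof (exp_pos (- x)). lra. Qed.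

Lemma ln_cosh_le_Rabs x : ln (cosh x) <= Rabs x.
Proof.
  rewrite <- (ln_exp (Rabs x)). apply ln_le; [apply cosh_pos|]. unfold cosh.
  assert (exp x <= exp (Rabs x)) by apply exp_le, Rle_abs.
  assert (exp (- x) <= exp (Rabs x)) by (apply exp_le; rewrite <- Rabs_Ropp; apply Rle_abs). lra.
Qed.

Lemma continuity_pt_ln_cosh x : continuity_pt (fun t => ln (cosh t)) x.
Proof.
  apply (continuity_pt_comp cosh ln).
  - apply derivable_continuous_pt, derivable_pt_cosh.
  - apply derivable_continuous_pt. exists (/ cosh x). apply derivable_pt_lim_ln, cosh_pos.
Qed.

Definition local_field (n : nat) (alpha : nat -> R) (J : nat -> nat -> R) (h : nat -> R)
  (x : vec) (l : nat) : R := sumR n (fun s => alpha s * J l s * x s) + h l.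

Lemma contn_quadJ n alpha J : contn n (quadJ n alpha J).
Proof.
  apply (contn_sum n n (fun l x => sumR n (fun s => alpha l * alpha s * J l s * x l * x s))).
  intros l Hl. apply (contn_sum n n (fun s x => alpha l * alpha s * J l s * x l * x s)).
  intros s Hs. apply contn_mult; [apply contn_scal|]; now apply contn_coord.
Qed.

Lemma contn_f_fun n alpha J h : contn n (f_fun n alpha J h).
Proof.
  apply contn_plus; [apply contn_scal, contn_quadJ|].
  apply (contn_sum n n (fun l x => alpha l * ln (cosh (local_field n alpha J h x l)))).
  intros l _. apply contn_scal.
  apply (contn_comp n (fun x => local_field n alpha J h x l) (fun t => ln (cosh t)));
    [|intros; apply continuity_pt_ln_cosh].
  apply contn_plus; [|apply contn_const].
  apply (contn_sum n n (fun s x => alpha s * J l s * x s)). intros s Hs.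
  now apply contn_scal, contn_coord.
Qed.

Lemma neg_form_quadJ n alpha J : (forall l, (l < n)%nat -> 0 < alpha l) -> pos_def n J ->
  neg_form n 1 (fun x => - / 2 * quadJ n alpha J x).
Proof.
  intros Ha (_ & Hpd). split; [lia|]. split; [apply contn_scal, contn_quadJ|]. split.
  - intros l y _. unfold quadJ. rewrite <- !sumR_scal. apply sumR_ext. intros i _.
    rewrite <- Rmult_assoc, <- !sumR_scal.
    apply sumR_ext. intros j _. simpl. ring.
  - intros y Hy. enough (0 < quadJ n alpha J y) by lra.
    (* The quadratic form at y is the form of J at the vector with entries alpha i * y i. *)
    assert (Hz : ~ is_zero_vec n (fun i => alpha i * y i)).
    { intros C. apply Hy. intros i Hi. specialize (C i Hi). specialize (Ha i Hi).
      apply Rmult_integral in C. destruct C; [lra | assumption]. }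
    specialize (Hpd _ Hz). unfold quadJ.
    erewrite sumR_ext; [exact Hpd|]. intros l _. apply sumR_ext. intros s _. simpl. ring.
Qed.

(** The terms ln cosh grow at most linearly in the norm w, and A w <= c w^2 / 2 + A^2 / (2 c) by
    completing the square, which spends half of the coercivity. *)
Lemma f_fun_quadratic_bound n alpha J h : (forall l, (l < n)%nat -> 0 < alpha l) -> pos_def n J ->
  exists c c', 0 < c /\ forall x, f_fun n alpha J h x <= c' - c * sumsq n x.
Proof.
  intros Ha Hpd. destruct (neg_form_coercive n 1 _ (neg_form_quadJ n alpha J Ha Hpd)) as (c & Hc & H).
  set (A := sumR n (fun l => alpha l * sumR n (fun s => Rabs (alpha s * J l s)))).
  set (B := sumR n (fun l => alpha l * Rabs (h l))).
  exists (c / 2), (B + A ^ 2 / (2 * c)). split; [lra|]. intros x.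
  specialize (H x). rewrite pow_1 in H. unfold f_fun.
  pose proof (sumsq_nonneg n x) as Hs. set (w := sqrt (sumsq n x)).
  assert (Hw : 0 <= w) by apply sqrt_pos.
  assert (Hww : w ^ 2 = sumsq n x) by (unfold w; rewrite <- Rsqr_pow2; now apply Rsqr_sqrt).
  assert (HL : sumR n (fun l => alpha l * ln (cosh (local_field n alpha J h x l))) <= A * w + B).
  { unfold A, B. rewrite (Rmult_comm _ w), <- sumR_scal, <- sumR_plus. apply sumR_le.
    intros l Hl. specialize (Ha l Hl).
    replace (w * (alpha l * sumR n (fun s => Rabs (alpha s * J l s))) + alpha l * Rabs (h l))
      with (alpha l * (w * sumR n (fun s => Rabs (alpha s * J l s)) + Rabs (h l))) by ring.
    apply Rmult_le_compat_l; [lra|]. eapply Rle_trans; [apply ln_cosh_le_Rabs|].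
    eapply Rle_trans; [apply Rabs_triang|]. apply Rplus_le_compat_r.
    eapply Rle_trans; [apply sumR_Rabs|]. rewrite <- sumR_scal. apply sumR_le. intros s Hs'.
    rewrite Rabs_mult, Rmult_comm. apply Rmult_le_compat_r; [apply Rabs_pos|].
    rewrite <- (sqrt_pow2 (Rabs (x s))) by apply Rabs_pos. apply sqrt_le_1_alt.
    rewrite pow2_abs. now apply sumsq_coord. }
  change (- / 2 * quadJ n alpha J x + sumR n (fun l => alpha l * ln (cosh (local_field n alpha J h x l)))
    <= B + A ^ 2 / (2 * c) - c / 2 * sumsq n x).
  rewrite <- Hww in *.
  assert (A * w <= c / 2 * w ^ 2 + A ^ 2 / (2 * c)); [|lra].
  assert (0 <= c / 2 * (w - A / c) ^ 2) by (apply Rmult_le_pos; [lra | apply pow2_ge_0]).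
  replace (c / 2 * (w - A / c) ^ 2) with (c / 2 * w ^ 2 + A ^ 2 / (2 * c) - A * w) in H0
    by (field; lra). lra.
Qed.

Definition bilJ (n : nat) (alpha : nat -> R) (J : nat -> nat -> R) (m x : vec) : R :=
  sumR n (fun l => sumR n (fun s => alpha l * alpha s * J l s * m l * x s)).

Lemma quadJ_vsub n alpha J x m : symmetric_mat n J ->
  quadJ n alpha J (vsub x m) = quadJ n alpha J x - 2 * bilJ n alpha J m x + quadJ n alpha J m.
Proof.
  intros Hsym.
  assert (Hb : bilJ n alpha J m x = bilJ n alpha J x m).
  { unfold bilJ. rewrite sumR_swap. apply sumR_ext. intros l Hl. apply sumR_ext. intros s Hs.
    rewrite (Hsym l s Hl Hs). ring. }
  replace (2 * bilJ n alpha J m x) with (bilJ n alpha J m x + bilJ n alpha J x m) by lra.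
  unfold quadJ, bilJ. rewrite <- sumR_plus, <- sumR_minus, <- sumR_plus. apply sumR_ext. intros l _.
  rewrite <- sumR_plus, <- sumR_minus, <- sumR_plus. apply sumR_ext. intros s _.
  unfold vsub. ring.
Qed.

(** The sum over independent spins factorizes, each site giving exp u + exp (- u) = 2 cosh u. *)
Lemma configs_exp_sum N (u : nat -> R) :
  sumL (fun sigma => exp (sumR N (fun i => spin sigma i * u i))) (configs N)
  = exp (sumR N (fun i => ln (2 * cosh (u i)))).
Proof.
  revert u; induction N as [|N IH]; intros u; [simpl; rewrite exp_0; lra|].
  simpl configs. rewrite sumL_flat_map, sumR_first, exp_plus, exp_ln
    by (pose proof (cosh_pos (u O)); lra).
  rewrite <- (IH (fun i => u (S i))), <- sumL_scal. apply sumL_ext. intros sigma.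
  unfold sumL. cbn [fold_right]. rewrite !sumR_first, !exp_plus.
  unfold spin at 1 3. simpl nth.
  change (fun i => spin (true :: sigma) (S i) * u (S i)) with (fun i => spin sigma i * u (S i)).
  change (fun i => spin (false :: sigma) (S i) * u (S i)) with (fun i => spin sigma i * u (S i)).
  unfold cosh. rewrite Rmult_1_l. replace (-1 * u O) with (- u O) by ring. field.
Qed.

Lemma sumR_by_block n N (part : nat -> nat) (c v : nat -> R) :
  (forall i, (i < N)%nat -> (part i < n)%nat) ->
  sumR N (fun i => c i * v (part i))
  = sumR n (fun l => sumR N (fun i => if Nat.eqb (part i) l then c i else 0) * v l).
Proof.
  intros Hp.
  rewrite (sumR_ext n _ (fun l => sumR N (fun i => (if Nat.eqb (part i) l then c i else 0) * v l))).
  - rewrite sumR_swap. apply sumR_ext. intros i Hi. now rewrite sumR_delta by auto.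
  - intros l _. rewrite Rmult_comm, <- sumR_scal. apply sumR_ext. intros; ring.
Qed.

Lemma block_size_sum N part l :
  INR (block_size N part l) = sumR N (fun i => if Nat.eqb (part i) l then 1 else 0).
Proof.
  unfold block_size. induction N as [|N IH]; [reflexivity|].
  rewrite seq_S, filter_app, length_app, plus_INR, IH. simpl.
  destruct (Nat.eqb (part N) l); simpl; lra.
Qed.

Lemma magn_inbox n alpha N part sigma : (forall l, (l < n)%nat -> 0 < alpha l) -> (1 <= N)%nat ->
  valid_partition n alpha N part -> inbox n 1 (magn N part sigma).
Proof.
  intros Ha HN (_ & Hsize) l Hl. unfold magn.
  assert (Hpos : 0 < INR (block_size N part l)).
  { rewrite Hsize by exact Hl. apply Rmult_lt_0_compat; [auto | apply lt_0_INR; lia]. }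
  unfold Rdiv. rewrite Rabs_mult, (Rabs_pos_eq (/ _)) by (left; now apply Rinv_0_lt_compat).
  apply Rmult_le_reg_r with (INR (block_size N part l)); [exact Hpos|].
  rewrite Rmult_assoc, Rinv_l, Rmult_1_r, Rmult_1_l by lra.
  rewrite block_size_sum. unfold block_sum. eapply Rle_trans; [apply sumR_Rabs|].
  apply sumR_le. intros i _. destruct (Nat.eqb (part i) l); [|rewrite Rabs_R0; lra].
  unfold spin. destruct (nth i sigma false); apply Rabs_le; lra.
Qed.

(** The Hubbard-Stratonovich identity: the terms quadratic in m cancel between N g(m) and - N/2 Q(x
    - m), and what remains is linear in the spins, with field [u] constant on each block. *)
Lemma gibbs_linearization n alpha J h N part x :
  (forall l, (l < n)%nat -> 0 < alpha l) -> sumR n alpha = 1 -> symmetric_mat n J ->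
  (1 <= N)%nat -> valid_partition n alpha N part ->
  sumL (fun sigma => gibbs_weight n alpha J h N part sigma *
      exp (INR N * (- / 2 * quadJ n alpha J (vsub x (magn N part sigma))))) (configs N)
  = exp (INR N * ln 2) * exp (INR N * f_fun n alpha J h x).
Proof.
  intros Ha Hsum Hsym HN (Hpart & Hsize).
  assert (HNp : 0 < INR N) by (apply lt_0_INR; lia).
  set (u := local_field n alpha J h x).
  assert (E : forall sigma,
    INR N * g_fun n alpha J h (magn N part sigma)
      + INR N * (- / 2 * quadJ n alpha J (vsub x (magn N part sigma)))
    = INR N * (- / 2 * quadJ n alpha J x) + sumR N (fun i => spin sigma i * u (part i))).
  { intros sigma. rewrite (sumR_by_block n N part (spin sigma) u Hpart), quadJ_vsub by exact Hsym.
    set (m := magn N part sigma). unfold g_fun.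
    assert (Hm : sumR n (fun l => sumR N (fun i => if Nat.eqb (part i) l then spin sigma i else 0) * u l)
       = INR N * (bilJ n alpha J m x + sumR n (fun l => alpha l * h l * m l))).
    { unfold bilJ. rewrite <- sumR_plus, <- sumR_scal. apply sumR_ext. intros l Hl.
      change (sumR N (fun i => if Nat.eqb (part i) l then spin sigma i else 0))
        with (block_sum N part sigma l).
      assert (Hml : block_sum N part sigma l = alpha l * INR N * m l).
      { unfold m, magn. rewrite Hsize by exact Hl. field. specialize (Ha l Hl). lra. }
      rewrite Hml. unfold u, local_field. rewrite Rmult_plus_distr_l, <- sumR_scal, Rmult_plus_distr_l.
      f_equal; [|ring]. rewrite <- sumR_scal. apply sumR_ext. intros; ring. }
    rewrite Hm. field. }
  rewrite (sumL_ext _ (fun sigma => exp (INR N * (- / 2 * quadJ n alpha J x)) *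
      exp (sumR N (fun i => spin sigma i * u (part i))))).
  2: { intros sigma. unfold gibbs_weight. now rewrite <- !exp_plus, E. }
  rewrite sumL_scal, (configs_exp_sum N (fun i => u (part i))), <- !exp_plus. f_equal.
  (* The factor 1 fits [sumR_by_block], whose inner sums then count sites and become the block
     sizes. *)
  rewrite (sumR_ext N _ (fun i => 1 * ln (2 * cosh (u (part i))))) by (intros; ring).
  rewrite (sumR_by_block n N part (fun _ => 1) (fun l => ln (2 * cosh (u l))) Hpart).
  rewrite (sumR_ext n _ (fun l => INR N * (ln 2 * alpha l + alpha l * ln (cosh (u l))))).
  - rewrite sumR_scal, sumR_plus, sumR_scal, Hsum. unfold f_fun. fold u.
    change (sumR n (fun l => alpha l * ln (cosh (sumR n (fun s => alpha s * J l s * x s) + h l))))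
      with (sumR n (fun l => alpha l * ln (cosh (u l)))). ring.
  - intros l Hl. rewrite <- block_size_sum, Hsize, ln_mult by first [exact Hl | apply cosh_pos | lra]. ring.
Qed.

Lemma configs_sum_pos N w : (forall sigma, 0 < w sigma) -> 0 < sumL w (configs N).
Proof.
  intros Hw. destruct (configs N) as [|z l] eqn:E.
  - exfalso. revert E. induction N as [|N IH]; simpl; [discriminate|].
    destruct (configs N); [now intros _; apply IH | discriminate].
  - assert (0 <= sumL w l); [|simpl; specialize (Hw z); unfold sumL in *; lra].
    unfold sumL. clear E. induction l as [|y l IH]; simpl; [lra|]. specialize (Hw y). lra.
Qed.

(* Both sides of [gibbs_linearization] are integrated against [phi]; the Gaussian
   centred at the magnetization concentrates there uniformly in the configuration. *)
Lemma gibbs_expect_integrals n alpha J h M phi b :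
  (forall l, (l < n)%nat -> 0 < alpha l) -> sumR n alpha = 1 -> pos_def n J ->
  contn n phi -> (forall x, Rabs (phi x) <= b) ->
  forall eps, 0 < eps -> exists N0 : nat, forall N part Iphi I1, (N0 <= N)%nat -> (1 <= N)%nat ->
    valid_partition n alpha N part ->
    Int n (fun x => phi x * exp (INR N * (f_fun n alpha J h x - M))) Iphi ->
    Int n (fun x => 1 * exp (INR N * (f_fun n alpha J h x - M))) I1 ->
    Rabs (gibbs_expect n alpha J h N part phi - Iphi / I1) <= eps.
Proof.
  intros Ha Hsum Hpd Hphi Hb eps Heps.
  set (T0 := fun x => - / 2 * quadJ n alpha J x).
  assert (HT0 : neg_form n 1 T0) by now apply neg_form_quadJ.
  destruct (Int_exp_form n 1 T0 HT0) as (B & HB & HIB).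
  destruct (neg_form_coercive n 1 T0 HT0) as (c & Hc & Hco).
  destruct (contn_unif_on_box n 1 phi (Rle_0_1) Hphi (eps / 2)) as (d & Hd & Hunif); [lra|].
  assert (Hb0 : 0 <= b) by (eapply Rle_trans; [apply Rabs_pos | apply (Hb (fun _ => 0))]).
  set (s := INR n / INR (2 * 1)).
  (* At distance d from the centre, T0 <= - c d^2 = - 2 eta: half of the exponent gives the decay
     exp(- N eta), and the other half stays as the integrable kernel [Kh]. *)
  set (eta := c * d ^ 2 / 2).
  assert (Heta : 0 < eta) by (unfold eta; pose proof (pow_lt d 2 Hd); nra).
  set (C2 := Rpower (/ 2) (- s)). assert (HC2 : 0 < C2) by apply exp_pos.
  (* The power of N is 0: both kernels have integrals proportional to [Z], so no polynomial factor
     has to be beaten. The tolerance is chosen to give delta * C2 <= eps / 2. *)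
  destruct (cv_exp_decay 0 eta Heta (eps / (4 * (b + 1) * C2))) as (N0 & HN0).
  { apply Rdiv_lt_0_compat; [lra|]. apply Rmult_lt_0_compat; lra. }
  exists N0. intros N part Iphi I1 HN HN1 Hval HIphi HI1.
  specialize (HN0 N HN). unfold Rdist in HN0.
  assert (HNp : 0 < INR N) by (apply lt_0_INR; lia).
  rewrite Rpower_O, Rmult_1_l, Rminus_0_r, Rabs_pos_eq in HN0 by (trivial; left; apply exp_pos).
  set (w := gibbs_weight n alpha J h N part).
  set (m := magn N part).
  set (l := configs N).
  set (Kf := fun sigma x => exp (INR N * T0 (vsub x (m sigma)))).
  set (Kh := fun sigma x => exp (INR N / 2 * T0 (vsub x (m sigma)))).
  set (Z := Rpower (INR N) (- s) * B).
  assert (HZ : 0 < Z) by (apply Rmult_lt_0_compat; [apply exp_pos | exact HB]).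
  assert (IK : forall sigma, Int n (Kf sigma) Z)
    by (intros sigma; now apply Int_exp_form_scaled).
  assert (IKh : forall sigma, Int n (Kh sigma) (C2 * Z)).
  { intros sigma. replace (C2 * Z) with (Rpower (INR N / 2) (- s) * B).
    - apply Int_exp_form_scaled; trivial. lra.
    - unfold Z, C2. change (INR N / 2) with (INR N * / 2).
      rewrite <- Rpower_mult_distr by lra. ring. }
  set (W := sumL w l).
  assert (HW : 0 < W) by (apply configs_sum_pos; intros; apply exp_pos).
  set (Wphi := sumL (fun sigma => w sigma * phi (m sigma)) l).
  set (C := exp (INR N * ln 2) * exp (INR N * M)).
  set (E := fun x => exp (INR N * (f_fun n alpha J h x - M))).
  assert (HS : forall x, sumL (fun sigma => w sigma * Kf sigma x) l = C * E x).
  { intros x. unfold C, E, w, Kf, m, l, T0. rewrite gibbs_linearization; trivial; [|apply Hpd].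
    rewrite <- !exp_plus. f_equal. ring. }
  (* The two sides of the linearization are the same function, so their integrals agree; this
     identifies the partition function. *)
  assert (HCI : W * Z = C * I1).
  { apply (Int_unique n (fun x => sumL (fun sigma => w sigma * Kf sigma x) l)).
    - unfold W. rewrite Rmult_comm, <- sumL_scal.
      apply (Int_lsumL n (fun sigma x => w sigma * Kf sigma x)). intros sigma.
      rewrite Rmult_comm. now apply Int_scal.
    - apply Int_ext with (fun x => C * (1 * E x)); [intros x; rewrite HS; ring|].
      now apply Int_scal. }
  set (delta := 2 * b * exp (- (INR N - 1) * eta)).
  assert (Hpt : forall x, Rabs (C * (phi x * E x) + -1 * sumL (fun sigma => w sigma * phi (m sigma) * Kf sigma x) l)
    <= sumL (fun sigma => w sigma * (eps / 2 * Kf sigma x + delta * Kh sigma x)) l).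
  { intros x. replace (C * (phi x * E x) + -1 * sumL (fun sigma => w sigma * phi (m sigma) * Kf sigma x) l)
      with (sumL (fun sigma => phi x * (w sigma * Kf sigma x) + -1 * (w sigma * phi (m sigma) * Kf sigma x)) l)
      by (rewrite sumL_plus, (sumL_scal (phi x)), HS,
            (sumL_scal (-1) (fun sigma => w sigma * phi (m sigma) * Kf sigma x)); ring).
    eapply Rle_trans; [apply sumL_Rabs|]. apply sumL_le. intros sigma.
    replace (phi x * (w sigma * Kf sigma x) + -1 * (w sigma * phi (m sigma) * Kf sigma x))
      with (w sigma * ((phi x - phi (m sigma)) * Kf sigma x)) by ring.
    assert (Hw : 0 < w sigma) by apply exp_pos.
    rewrite Rabs_mult, (Rabs_pos_eq (w sigma)) by lra. apply Rmult_le_compat_l; [lra|].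
    assert (HKf : 0 < Kf sigma x) by apply exp_pos.
    assert (HKh : 0 < Kh sigma x) by apply exp_pos.
    assert (Hdelta : 0 <= delta) by (apply Rmult_le_pos; [lra | left; apply exp_pos]).
    rewrite Rabs_mult, (Rabs_pos_eq (Kf sigma x)) by lra.
    destruct (classic (near n d x (m sigma))) as [Hnear|Hfar].
    - assert (Rabs (phi x - phi (m sigma)) < eps / 2).
      { apply Hunif; [|exact Hnear]. now apply magn_inbox with alpha. }
      assert (0 <= delta * Kh sigma x) by (apply Rmult_le_pos; lra). nra.
    - assert (Rabs (phi x - phi (m sigma)) <= 2 * b).
      { eapply Rle_trans; [unfold Rminus; apply Rabs_triang|]. rewrite Rabs_Ropp.
        pose proof (Hb x). pose proof (Hb (m sigma)). lra. }
      assert (Kf sigma x <= exp (- (INR N - 1) * eta) * Kh sigma x).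
      { unfold Kf, Kh. rewrite <- exp_plus. apply exp_le.
        apply not_all_ex_not in Hfar as (i & Hfar). apply imply_to_and in Hfar as (Hi & Hfar).
        apply Rnot_lt_le in Hfar. specialize (Hco (vsub x (m sigma))). rewrite pow_1 in Hco.
        pose proof (sumsq_coord n (vsub x (m sigma)) i Hi) as Hsq. unfold vsub at 1 in Hsq.
        rewrite <- pow2_abs in Hsq.
        assert (d ^ 2 <= Rabs (x i - m sigma i) ^ 2) by (apply pow_incr; lra).
        assert (c * d ^ 2 <= c * sumsq n (vsub x (m sigma))) by (apply Rmult_le_compat_l; lra).
        assert (HT : T0 (vsub x (m sigma)) <= - (2 * eta)) by (unfold eta; lra).
        apply Rmult_le_compat_l with (r := INR N / 2) in HT; lra. }
      apply Rle_trans with (2 * b * (exp (- (INR N - 1) * eta) * Kh sigma x)).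
      + apply Rmult_le_compat; try lra. apply Rabs_pos.
      + rewrite <- Rmult_assoc. fold delta. assert (0 <= eps / 2 * Kf sigma x) by (apply Rmult_le_pos; lra). lra. }
  assert (ID : Int n (fun x => C * (phi x * E x) + -1 * sumL (fun sigma => w sigma * phi (m sigma) * Kf sigma x) l)
    (C * Iphi + -1 * (Wphi * Z))).
  { apply Int_plus; [now apply Int_scal|]. apply Int_scal.
    unfold Wphi. rewrite Rmult_comm, <- sumL_scal.
    apply (Int_lsumL n (fun sigma x => w sigma * phi (m sigma) * Kf sigma x)). intros sigma.
    cbv beta. rewrite (Rmult_comm Z). now apply Int_scal. }
  assert (IE : Int n (fun x => sumL (fun sigma => w sigma * (eps / 2 * Kf sigma x + delta * Kh sigma x)) l)
    ((eps / 2 * Z + delta * (C2 * Z)) * W)).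
  { unfold W. rewrite <- sumL_scal.
    apply (Int_lsumL n (fun sigma x => w sigma * (eps / 2 * Kf sigma x + delta * Kh sigma x))).
    intros sigma. cbv beta. rewrite (Rmult_comm _ (w sigma)). apply Int_scal, Int_plus; now apply Int_scal. }
  pose proof (Int_Rabs_le n _ _ _ _ ID IE Hpt) as Hfin.
  assert (Hdc : delta * C2 <= eps / 2).
  { apply Rmult_lt_compat_r with (r := 2 * (b + 1) * C2) in HN0;
      [|apply Rmult_lt_0_compat; lra].
    replace (eps / (4 * (b + 1) * C2) * (2 * (b + 1) * C2)) with (eps / 2) in HN0 by (field; lra).
    assert (0 < exp (- (INR N - 1) * eta) * C2) by (apply Rmult_lt_0_compat; [apply exp_pos | exact HC2]).
    unfold delta. nra. }
  assert (HC : 0 < C) by (apply Rmult_lt_0_compat; apply exp_pos).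
  assert (HWZ : 0 < W * Z) by now apply Rmult_lt_0_compat.
  assert (HI1p : I1 = W * Z / C) by (rewrite HCI; field; lra).
  change (gibbs_expect n alpha J h N part phi) with (Wphi / W).
  (* By W Z = C I1 both ratios have the denominator W Z, and the numerator is the integral bounded
     in [Hfin]. *)
  replace (Wphi / W - Iphi / I1) with (- ((C * Iphi + -1 * (Wphi * Z)) / (W * Z)))
    by (rewrite HI1p; field; lra).
  rewrite Rabs_Ropp. unfold Rdiv at 1. rewrite Rabs_mult, (Rabs_pos_eq (/ _))
    by (left; now apply Rinv_0_lt_compat).
  apply Rmult_le_reg_r with (W * Z); [exact HWZ|].
  rewrite Rmult_assoc, Rinv_l, Rmult_1_r by lra.
  eapply Rle_trans; [exact Hfin|].
  replace ((eps / 2 * Z + delta * (C2 * Z)) * W) with ((eps / 2 + delta * C2) * (W * Z)) by ring.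
  apply Rmult_le_compat_r; lra.
Qed.

(** * The limit law *)

Lemma hom_poly_scale n d T l y : hom_poly n d T -> T (fun i => l * y i) = l ^ d * T y.
Proof.
  intros (terms & Hd & HT). rewrite !HT.
  assert (Hm : forall m e, monomial m e (fun i => l * y i) = l ^ sumN m e * monomial m e y).
  { intros m e. unfold monomial. induction m as [|m IH]; simpl; [ring|].
    rewrite IH, Rpow_mult_distr, pow_add. ring. }
  clear HT. induction terms as [|t terms IH]; simpl; [ring|].
  rewrite IH by (intros; apply Hd; now right).
  rewrite Hm, (Hd t) by now left. ring.
Qed.

Lemma contn_hom_poly n d T : hom_poly n d T -> contn n T.
Proof.
  intros (terms & _ & HT). apply contn_ext with (1 := fun x => eq_sym (HT x)). clear HT.
  assert (Hm : forall m e, (m <= n)%nat -> contn n (monomial m e)).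
  { intros m e. unfold monomial. induction m as [|m IH]; intros Hm; simpl; [apply contn_const|].
    apply contn_mult; [apply IH; lia|].
    apply (contn_comp n (fun x => x m) (fun t => t ^ e m)); [apply contn_coord; lia|].
    intros x. apply derivable_continuous_pt, derivable_pt_pow. }
  induction terms as [|t terms IH]; simpl; [apply contn_const|].
  apply contn_plus; [|exact IH]. apply contn_scal, Hm. lia.
Qed.

Lemma hom_type_neg_form n F mu k T : hom_type n F mu k T -> neg_form n k T /\ taylor n F mu k T.
Proof.
  intros (Hk & Hhom & Hneg & Htay). split; [|exact Htay]. split; [exact Hk|].
  split; [now apply (contn_hom_poly n (2 * k))|]. split; [|exact Hneg].
  intros l y _. now apply (hom_poly_scale n).
Qed.

Lemma quotient_close A B eps : 0 < B -> 0 < eps -> exists d, 0 < d /\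
  forall x y, Rabs (x - A) < d -> Rabs (y - B) < d -> Rabs (x / y - A / B) < eps.
Proof.
  intros HB He. pose proof (Rabs_pos A).
  (* The numerator of the difference is at most q (B + |A|) = eps B^2 / 4, the denominator above B^2
     / 2. *)
  set (q := eps * B ^ 2 / (4 * (B + Rabs A))).
  assert (Hq : 0 < q).
  { apply Rdiv_lt_0_compat; [apply Rmult_lt_0_compat; [exact He | now apply pow_lt] | lra]. }
  exists (Rmin (B / 2) q). split; [apply Rmin_pos; lra|]. intros x y Hx Hy.
  pose proof (Rmin_l (B / 2) q). pose proof (Rmin_r (B / 2) q).
  assert (Hyb : B / 2 < y) by (apply Rabs_lt_between in Hy; lra).
  replace (x / y - A / B) with (((x - A) * B - A * (y - B)) / (y * B)) by (field; lra).
  assert (HyB : B ^ 2 / 2 < y * B) by nra. pose proof (pow_lt B 2 HB).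
  unfold Rdiv at 1. rewrite Rabs_mult, (Rabs_pos_eq (/ _)) by (left; apply Rinv_0_lt_compat; lra).
  apply Rmult_lt_reg_r with (y * B); [lra|].
  rewrite Rmult_assoc, Rinv_l, Rmult_1_r by lra.
  apply Rle_lt_trans with (q * (B + Rabs A)).
  - eapply Rle_trans; [unfold Rminus; apply Rabs_triang|].
    rewrite Rabs_Ropp, !Rabs_mult, (Rabs_pos_eq B) by lra.
    unfold Rminus in *. pose proof (Rabs_pos (x + - A)). pose proof (Rabs_pos (y + - B)). nra.
  - replace (q * (B + Rabs A)) with (eps * (B ^ 2 / 4)) by (unfold q; field; lra).
    apply Rmult_lt_compat_l; lra.
Qed.

Lemma Int_weighted_exists n f M c c' phi b N : contn n f -> 0 < c ->
  (forall x, f x - M <= c' - c * sumsq n x) -> contn n phi -> (forall x, Rabs (phi x) <= b) ->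
  (1 <= N)%nat -> exists I, Int n (fun x => phi x * exp (INR N * (f x - M))) I.
Proof.
  intros Hf Hc Hdec Hphi Hb HN. assert (HNp : 0 < INR N) by (apply lt_0_INR; lia).
  assert (Hb0 : 0 <= b) by (eapply Rle_trans; [apply Rabs_pos | apply (Hb (fun _ => 0))]).
  apply Int_exists_gaussian with (C := b * exp (INR N * c')) (c := INR N * c).
  - apply contn_mult; [exact Hphi|]. apply contn_exp, contn_scal.
    apply contn_plus; [exact Hf | apply contn_const].
  - now apply Rmult_lt_0_compat.
  - intros x. rewrite Rabs_mult, (Rabs_pos_eq (exp _)) by (left; apply exp_pos).
    rewrite Rmult_assoc, <- exp_plus. apply Rmult_le_compat; trivial;
      [apply Rabs_pos | left; apply exp_pos |].
    apply exp_le. specialize (Hdec x).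
    apply Rmult_le_compat_l with (r := INR N) in Hdec; lra.
Qed.

Theorem mainTheorem12
  (n : nat) (alpha : nat -> R) (J : nat -> nat -> R) (h : nat -> R)
  (Hn : (1 <= n)%nat)
  (Halpha : forall l, (l < n)%nat -> 0 < alpha l < 1)
  (Hsum : sumR n alpha = 1)
  (Hsym : symmetric_mat n J)
  (Hdiag : forall l, (l < n)%nat -> 0 < J l l)
  (Hpd : pos_def n J)
  (Htypes : forall mu, global_max n (f_fun n alpha J h) mu ->
              exists k T, hom_type n (f_fun n alpha J h) mu k T)
  (kstar : nat)
  (Hkstar_attained : exists mu T, global_max n (f_fun n alpha J h) mu /\
              hom_type n (f_fun n alpha J h) mu kstar T)
  (Hkstar_max : forall mu k T, global_max n (f_fun n alpha J h) mu ->
              hom_type n (f_fun n alpha J h) mu k T -> (k <= kstar)%nat)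
  (P : nat) (mu : nat -> vec) (T : nat -> vec -> R)
  (Hmu : forall p, (p < P)%nat ->
           global_max n (f_fun n alpha J h) (mu p) /\
           hom_type n (f_fun n alpha J h) (mu p) kstar (T p))
  (Hmu_distinct : forall p q, (p < P)%nat -> (q < P)%nat -> p <> q ->
           ~ eqv n (mu p) (mu q))
  (Hmu_all : forall nu T', global_max n (f_fun n alpha J h) nu ->
           hom_type n (f_fun n alpha J h) nu kstar T' ->
           exists p, (p < P)%nat /\ eqv n nu (mu p)) :
  exists b : nat -> R,
    (forall p, (p < P)%nat ->
       integral_Rn n
         (fun x => exp (T p (vdiv_pow alpha (/ INR (2 * kstar)) x))) (b p)) /\
    (forall phi : vec -> R,
       depends_on_first n phi -> continuous_Rn n phi -> bounded_fun phi ->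
       forall eps, 0 < eps -> exists N0 : nat,
         forall (N : nat) (part : nat -> nat), (N0 <= N)%nat ->
           valid_partition n alpha N part ->
           Rabs (gibbs_expect n alpha J h N part phi
                 - sumR P (fun p => b p * phi (mu p)) / sumR P b) < eps).
Proof.
  set (f := f_fun n alpha J h) in *.
  assert (Ha : forall l, (l < n)%nat -> 0 < alpha l) by (intros l Hl; now apply Halpha).
  assert (Hf : contn n f) by apply contn_f_fun.
  destruct Hkstar_attained as (nu & Tnu & Hnu & HTnu).
  (* Since [kstar] is attained, the list of maxima has an element, which makes the denominator
     positive. *)
  destruct (Hmu_all nu Tnu Hnu HTnu) as (p0 & Hp0 & _).
  set (M := f nu).
  destruct (f_fun_quadratic_bound n alpha J h Ha Hpd) as (c & c0 & Hc & Hdec0). fold f in Hdec0.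
  set (c' := c0 - M).
  assert (Hdec : forall x, f x - M <= c' - c * sumsq n x)
    by (intros x; specialize (Hdec0 x); unfold c'; lra).
  destruct (finite_choice P (fun p B => 0 < B /\ Int n (fun x => exp (T p x)) B)) as (B & HB).
  { intros p Hp. apply (Int_exp_form n kstar (T p)).
    now apply (hom_type_neg_form n f (mu p)), Hmu. }
  set (lam := fun i => / Rpower (alpha i) (/ INR (2 * kstar))).
  assert (Hlam : forall i, (i < n)%nat -> 0 < lam i)
    by (intros; apply Rinv_0_lt_compat, exp_pos).
  pose proof (prodR_pos n lam Hlam) as HA. set (A := / prodR n lam).
  assert (HA' : 0 < A) by now apply Rinv_0_lt_compat.
  exists (fun p => A * B p). split.
  { intros p Hp. apply Int_integral_Rn.
    apply Int_ext with (2 := Int_diag_scale n _ _ lam Hlam (proj2 (HB p Hp))).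
    intros x. do 2 f_equal. apply functional_extensionality. intros i.
    unfold lam, vdiv_pow, Rdiv. ring. }
  intros phi _ Hcont (b & Hb) eps Heps.
  apply continuous_Rn_contn in Hcont.
  assert (Hmax : forall p, (p < P)%nat -> f (mu p) = M /\ neg_form n kstar (T p) /\
    taylor n f (mu p) kstar (T p) /\ 0 < B p /\ Int n (fun x => exp (T p x)) (B p)).
  { intros p Hp. destruct (Hmu p Hp) as (Hg & Hty).
    destruct (hom_type_neg_form n f (mu p) kstar (T p) Hty). destruct (HB p Hp).
    repeat split; trivial; try apply H. apply Rle_antisym; [apply Hnu | apply Hg]. }
  assert (Hother : forall t, (forall p, (p < P)%nat -> ~ eqv n t (mu p)) -> f t < M \/
    (f t = M /\ exists k T', (k < kstar)%nat /\ neg_form n k T' /\ taylor n f t k T')).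
  { intros t Ht. destruct (Rle_lt_or_eq_dec (f t) M (Hnu t)) as [Hlt|Heq]; [now left|right].
    split; [exact Heq|].
    assert (Hg : global_max n f t) by (intros y; rewrite Heq; apply Hnu).
    destruct (Htypes t Hg) as (k & T' & Hty). exists k, T'.
    split; [|now apply hom_type_neg_form].
    pose proof (Hkstar_max t k T' Hg Hty). destruct (Nat.eq_dec k kstar) as [->|]; [|lia].
    destruct (Hmu_all t T' Hg Hty) as (p & Hp & C). now elim (Ht p Hp). }
  assert (Hone : forall x, Rabs ((fun _ : vec => 1) x) <= 1) by (intros; rewrite Rabs_R1; lra).
  set (Lphi := sumR P (fun p => B p * phi (mu p))).
  set (L1 := sumR P (fun p => B p * 1)).
  assert (HL1 : 0 < L1).
  { apply sumR_pos with p0; [intros p Hp; destruct (HB p Hp); lra | exact Hp0|].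
    destruct (HB p0 Hp0). lra. }
  destruct (quotient_close Lphi L1 (eps / 2) HL1) as (d & Hd & Hquot); [lra|].
  destruct (laplace_limit n f M kstar P mu T B c c' phi b Hn Hf Hc Hdec Hmax Hmu_distinct Hother
    Hcont Hb d Hd) as (Na & HNa).
  destruct (laplace_limit n f M kstar P mu T B c c' (fun _ => 1) 1 Hn Hf Hc Hdec Hmax Hmu_distinct
    Hother (contn_const n 1) Hone d Hd) as (Nb & HNb).
  destruct (gibbs_expect_integrals n alpha J h M phi b Ha Hsum Hpd Hcont Hb (eps / 2))
    as (Nc & HNc); [lra|].
  exists (S (Na + Nb + Nc)). intros N part HN Hval.
  destruct (Int_weighted_exists n f M c c' phi b N Hf Hc Hdec Hcont Hb) as (Iphi & HIphi); [lia|].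
  destruct (Int_weighted_exists n f M c c' (fun _ => 1) 1 N Hf Hc Hdec (contn_const n 1) Hone)
    as (I1 & HI1); [lia|].
  specialize (HNa N Iphi (ltac:(lia)) (ltac:(lia)) HIphi).
  specialize (HNb N I1 (ltac:(lia)) (ltac:(lia)) HI1).
  specialize (HNc N part Iphi I1 (ltac:(lia)) (ltac:(lia)) Hval HIphi HI1).
  set (r := Rpower (INR N) (INR n / INR (2 * kstar))) in *.
  assert (Hr : 0 < r) by apply exp_pos.
  specialize (Hquot _ _ HNa HNb).
  assert (HI10 : I1 <> 0).
  { assert (HE : contn n (fun x => 1 * exp (INR N * (f x - M)))).
    { apply contn_scal, contn_exp, contn_scal. apply contn_plus; [exact Hf | apply contn_const]. }
    assert (HE0 : forall x, 0 < 1 * exp (INR N * (f x - M)))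
      by (intros; rewrite Rmult_1_l; apply exp_pos).
    destruct (contn_pos_near_zero n _ HE (HE0 _)) as (e & rho & He & Hrho & Hlow).
    pose proof (Int_pos n _ I1 e rho HI1 (fun x => Rlt_le _ _ (HE0 x)) He Hrho Hlow). lra. }
  replace (r * Iphi / (r * I1)) with (Iphi / I1) in Hquot by (field; lra).
  replace (sumR P (fun p => A * B p * phi (mu p)) / sumR P (fun p => A * B p)) with (Lphi / L1).
  - apply Rabs_le_between in HNc. apply Rabs_lt_between in Hquot. apply Rabs_lt_between. lra.
  - unfold Lphi, L1. rewrite sumR_scal.
    rewrite (sumR_ext P (fun p => A * B p * phi (mu p)) (fun p => A * (B p * phi (mu p))))
      by (intros; ring).
    rewrite sumR_scal, (sumR_ext P (fun p => B p * 1) B) by (intros; ring).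
    unfold L1 in HL1. rewrite (sumR_ext P (fun p => B p * 1) B) in HL1 by (intros; ring).
    field. lra.
Qed.
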